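(* Let $c\in\mathbb{R}$ be a constant and $p(n)=\frac{\log n+c+o(1)}{n}$. Then $$\lim_{n\to\infty}\mathrm{P}\bigl(G_{n,p(n)}\in\mathcal{D}^n\bigr)\ \ge\ e^{-2e^{-c}}\bigl(1+2e^{-c}+e^{-2c}\bigr).$$
   Context: A digraph $G=(V,E)$ on $n$ vertices has $V=\{1,\dots,n\}$ and $E\subseteq V\times V$ (self-loops $(i,i)$ allowed). Its structured matrix $\bar A\in\{0,*\}^{n\times n}$ has $\bar A_{ij}=*$ if $(i,j)\in E$ and $\bar A_{ij}=0$ otherwise. A realization of $\bar A$ is a real matrix obtained by assigning real numbers to the $*$ entries and keeping the zero entries. $G$ (equivalently $\bar A$) is structurally diagonalizable if for almost all (with respect to Lebesgue measure on $\mathbb{R}^{|E|}$) real assignments to the $*$ entries, the resulting matrix is diagonalizable (over $\mathbb{C}$). $\mathcal{D}^n$ is the set of structurally diagonalizable digraphs with $n$ vertices. In the random digraph model $\mathcal{G}(n,p)$ on $n$ labeled vertices, each of the $n^2$ ordered pairs $(u,v)$ (including self-loops $u=v$) is an edge independently with probability $p$. $G_{n,p(n)}$ denotes a random digraph sampled from $\mathcal{G}(n,p(n))$. *)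

(* Defs.v *)
From HB Require Import structures.
From mathcomp Require Import all_boot all_order all_algebra.
From mathcomp Require Import all_classical all_reals all_analysis.
From mathcomp Require Import complex.

Set Implicit Arguments.
Unset Strict Implicit.
Unset Printing Implicit Defensive.

Import Order.TTheory GRing.Theory Num.Theory.
Import numFieldNormedType.Exports.

Local Open Scope classical_set_scope.
Local Open Scope ring_scope.

Section lebesgue_step.
Context (R : realType) (m : nat).
Variable mu : {sigma_finite_measure set (m.-tuple (measurableTypeR R)) -> \bar R}.

Definition tuple_of_pair (z : measurableTypeR R * m.-tuple (measurableTypeR R)) :
  m.+1.-tuple (measurableTypeR R) := [tuple of z.1 :: z.2].

Lemma measurable_tuple_of_pair : measurable_fun [set: _] tuple_of_pair.
Proof. by apply: measurable_cons. Qed.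

Definition lebesgue_step : set (m.+1.-tuple (measurableTypeR R)) -> \bar R :=
  pushforward (lebesgue_measure \x mu)%E tuple_of_pair.

Let step0 : lebesgue_step set0 = 0%E.
Proof. by rewrite /lebesgue_step /pushforward preimage_set0 measure0. Qed.

Let step_ge0 A : (0 <= lebesgue_step A)%E.
Proof. exact: (measure_ge0 (lebesgue_measure \x mu)%E). Qed.

Let step_sigma_additive : semi_sigma_additive lebesgue_step.
Proof.
move=> F mF tF mUF; rewrite /lebesgue_step /pushforward preimage_bigcup.
have mp A : measurable A -> measurable (tuple_of_pair @^-1` A).
  by move=> mA; rewrite -[X in measurable X]setTI; exact: measurable_tuple_of_pair.
apply: measure_semi_sigma_additive.
- by move=> n; exact: mp.
- apply/trivIsetP => /= i j _ _ ij; rewrite -preimage_setI.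
  by move/trivIsetP : tF => /(_ _ _ _ _ ij) ->//; rewrite preimage_set0.
- by rewrite -preimage_bigcup; exact: mp.
Qed.

HB.instance Definition _ := isMeasure.Build _ _ _
  lebesgue_step step0 step_ge0 step_sigma_additive.

Let step_sigma_finite : sigma_finite setT lebesgue_step.
Proof.
have [F TF Foo] : exists2 F : (set _)^nat, setT = \bigcup_k F k &
    forall k, measurable (F k) /\ ((lebesgue_measure \x mu) (F k) < +oo)%E.
  have /sigma_finiteP[F [TF ndF Foo]] := sigma_finiteT (@lebesgue_measure R).
  have /sigma_finiteP[G [TG ndG Goo]] := sigma_finiteT mu.
  exists (fun k => F k `*` G k).
    rewrite -setXTT TF TG predeqE => -[x y]; split.
      move=> [/= [i _ Fx] [k _ Gy]]; exists (maxn i k) => //; split.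
      - by move: x Fx; exact/subsetPset/ndF/leq_maxl.
      - by move: y Gy; exact/subsetPset/ndG/leq_maxr.
    by move=> [i _ []/= ? ?]; split; exists i.
  move=> k; have [? ?] := Foo k; have [? ?] := Goo k.
  split; first exact: measurableX.
  by rewrite product_measure1E// lte_mul_pinfty// ge0_fin_numE.
pose unc (t : m.+1.-tuple (measurableTypeR R)) := (thead t, [tuple of behead t]).
have mu_unc : measurable_fun setT unc.
  apply/measurable_fun_pair; first exact: measurable_tnth.
  exact: measurable_behead.
have uncK z : unc (tuple_of_pair z) = z.
  case: z => x t; rewrite /unc /tuple_of_pair theadE/=; congr pair.
  exact/val_inj.
exists (fun k => unc @^-1` F k).
  by rewrite -preimage_bigcup -TF preimage_setT.
move=> k; have [mFk Fkoo] := Foo k; split.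
  by rewrite -[X in measurable X]setTI; exact: mu_unc.
rewrite /lebesgue_step /pushforward -comp_preimage.
by rewrite (_ : unc \o tuple_of_pair = id) ?preimage_id//; exact/funext.
Qed.

HB.instance Definition _ := Measure_isSigmaFinite.Build _ _ _
  lebesgue_step step_sigma_finite.

End lebesgue_step.

(* Lebesgue measure on R^m, as an iterated product measure on m.-tuple R; the
   lemma lebesgue_tuple_box below is the usual characterization. *)
Fixpoint lebesgue_tuple (R : realType) (m : nat) :
    {sigma_finite_measure set (m.-tuple (measurableTypeR R)) -> \bar R} :=
  if m is m'.+1 then lebesgue_step (lebesgue_tuple R m') else dirac [tuple].

Lemma lebesgue_tuple_box (R : realType) (m : nat)
    (A : 'I_m -> set (measurableTypeR R)) :
  (forall i, measurable (A i)) ->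
  lebesgue_tuple R m [set x | forall i, A i (tnth x i)] =
  (\prod_(i < m) lebesgue_measure (A i))%E.
Proof.
elim: m A => [|m IHm] A mA.
  rewrite big_ord0/= diracE mem_set//=; by case.
rewrite big_ord_recl -(IHm (A \o lift ord0))//=.
rewrite -product_measure1E//; last first.
  rewrite [X in measurable X](_ : _ =
    \bigcap_(i in [set` 'I_m]) ((fun x => tnth x i) @^-1` A (lift ord0 i))).
    apply: fin_bigcap_measurable => // i _.
    by rewrite -[X in measurable X]setTI; apply: measurable_tnth.
  by apply/seteqP; split=> x /= h i; [move=> _|]; exact: h.
rewrite /lebesgue_step /pushforward; congr product_measure1.
apply/seteqP; split=> -[x t] /=.
  move=> h; split; first by have := h ord0.
  by move=> i; have := h (lift ord0 i); rewrite tnthS.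
by move=> [hx ht] i; case: (unliftP ord0 i) => [j|] ->; rewrite ?tnthS//; exact: ht.
Qed.

(* (i, j) \in E is an edge; self-loops (i, i) are allowed. *)
Notation digraph n := {set 'I_n * 'I_n}.

(* An assignment of reals to the free entries is a vector x of R^|E|, whose
   coordinates are matched with the edges through enum E. *)
Definition realization (R : realType) (n : nat) (E : digraph n)
    (x : #|E|.-tuple R) : 'M[R]_n :=
  \matrix_(i, j) if (i, j) \in E then x`_(index (i, j) (enum E)) else 0.

Definition structurally_diagonalizable (R : realType) (n : nat)
    (E : digraph n) : Prop :=
  {ae lebesgue_tuple R #|E|, forall x,
    diagonalizable (map_mx (real_complex R) (realization x))}.

(* Law of the random digraph G(n,p), as a mass function. The formula makes sense
   for every real p, but is a probability only when 0 <= p <= 1. *)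
Definition gnp_mass (R : realType) (n : nat) (p : R) (E : digraph n) : R :=
  \prod_(e : 'I_n * 'I_n) (if e \in E then p else 1 - p).

Definition gnp_prob (R : realType) (n : nat) (p : R) (Q : digraph n -> Prop) : R :=
  \sum_(E : digraph n | `[< Q E >]) gnp_mass p E.

Lemma gnp_prob_total (R : realType) (n : nat) (p : R) :
  gnp_prob p (fun _ : digraph n => True) = 1.
Proof.
rewrite /gnp_prob (eq_bigl xpredT) => [|E]; last exact/asboolT.
rewrite /gnp_mass -(@bigA_distr _ 0 1 *%R +%R _ (fun=> p) (fun=> 1 - p)).
by rewrite big1// => e _ /=; exact: subrKC.
Qed.

(* The edges are independent, each present with probability p. *)
Lemma gnp_prob_edges (R : realType) (n : nat) (p : R) (S : digraph n) :
  gnp_prob p (fun E : digraph n => S \subset E) = p ^+ #|S|.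
Proof.
transitivity (\prod_(e : 'I_n * 'I_n) (p + (if e \in S then 0 else 1 - p))).
  rewrite bigA_distr/= /gnp_prob (eq_bigl (fun E : digraph n => S \subset E)).
    rewrite big_mkcond; apply: eq_bigr => E _; case: ifPn => [/fintype.subsetP SE|].
      by apply: eq_bigr => e _; case: ifPn => // /(contra (SE e)) /negbTE ->.
    move=> /fintype.subsetPn[e eS eE]; rewrite (bigD1 e)//= (negbTE eE) eS.
    by rewrite mul0r.
  by move=> E; rewrite asboolb.
rewrite -prodr_const [RHS]big_mkcond; apply: eq_bigr => e _.
by case: ifPn => _; rewrite ?addr0// subrKC.
Qed.

(* Main.v *)
Require Import Defs.
From mathcomp Require Import all_boot all_order all_algebra all_fingroup all_field.
From mathcomp Require Import zify ring lra.

Set Implicit Arguments.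
Unset Strict Implicit.
Unset Printing Implicit Defensive.

(* Let A be the set of sinks and B the set of sources, a vertex counting as such
   only if it carries no loop. With l = e^(-c), the numbers |A| and |B| are
   asymptotically independent Poisson variables of mean l, and with high
   probability the digraph is structurally diagonalizable exactly when A or B is
   empty. Hence the limit is 2 e^(-l) - e^(-2l) = e^(-2l) (2 e^l - 1), and the bound
   is the quadratic Taylor estimate 2 e^l - 1 >= 1 + 2l + l^2.

   Write Z for A :|: B. If S and T are sets of the same cardinality between A and Z,
   resp. B and Z, then with high probability the edges outside S and T contain a
   perfect matching from ~: S to ~: T: otherwise a smallest violator of Hall's
   condition, in the digraph or in its converse, is a set K of k <= (n + 1) / 2
   vertices with k - 1 out-neighbours besides sinks, each hit by at least two
   edges, and the expected number of such configurations tends to 0.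

   If B is empty, take S = T = A. Then the block M' of a realization M on ~: A
   generically has distinct nonzero eigenvalues, because this holds for suitable
   weights on the matching (a union of cycles), and 'X * char_poly M' annihilates M.
   The case of A empty is dual. If a \in A and b \in B, take S = Z :\ b and
   T = Z :\ a: generically rank M >= n - |Z| + 1, whereas M *m M = M *m J *m M for J
   the projection away from Z, so rank (M *m M) < rank M and M is not
   diagonalizable. *)

(** * Hall's theorem and its violators in a digraph *)

Section Hall.
Variable T : finType.
Implicit Types (r : rel T) (X K L : {set T}).

Definition rel_image r K : {set T} := [set y | [exists x in K, r x y]].

(** Halmos-Vaughan induction on [#|X|]. If a proper nonempty [K] has an image no larger than itself,
    [K] and the rest are matched separately; otherwise every such [K] has a spare image point, so
    any edge from [x] to [y] can be fixed and removed. *)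
Lemma hall_injection r X :
  (forall K, K \subset X -> #|K| <= #|rel_image r K|) ->
  exists2 f : T -> T, {in X &, injective f} & {in X, forall x, r x (f x)}.
Proof.
have [m] := ubnP #|X|; elim: m r X => // m IH r X; rewrite ltnS => Xm hallX.
have [->|[x xX]] := set_0Vmem X; first by exists id => ?; rewrite inE.
have [/existsP[K /and4P[KX K0 KnX NK]]|/existsPn tight] :=
    boolP [exists K : {set T}, [&& K \subset X, K != set0, K != X & #|rel_image r K| <= #|K|]].
  have KpX : K \proper X by rewrite properEneq KnX.
  have [| |f1 f1_inj f1r] := IH r K.
  - exact: leq_trans (proper_card KpX) Xm.
  - by move=> L LK; apply: hallX; exact: subset_trans LK KX.
  (* The rest is matched outside the image of [K]: Hall's condition for [L] there follows from that
     for [K :|: L], the image of [K] having at most [#|K|] points. *)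
  have [| |f2 f2_inj f2r] := IH (fun a b => r a b && (b \notin rel_image r K)) (X :\: K).
  - have := cardsID K X; rewrite (setIidPr KX); move: K0; rewrite -card_gt0; lia.
  - move=> L /subsetDP[LX LK].
    have KL : #|K :|: L| = #|K| + #|L|.
      by rewrite cardsU disjoint_setI0 1?disjoint_sym// cards0 subn0.
    have := hallX (K :|: L); rewrite subUset KX LX KL => /(_ isT).
    suff : #|rel_image r (K :|: L)| <= #|rel_image r K| +
      #|rel_image (fun a b => r a b && (b \notin rel_image r K)) L| by lia.
    apply: leq_trans (leq_card_setU _ _); apply/subset_leq_card/subsetP => y.
    rewrite !inE => /existsP[z /andP[/setUP[zK|zL] zy]].
      by apply/orP; left; apply/existsP; exists z; rewrite zK.
    case: (boolP [exists _ in K, _]) => //= nK.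
    by apply/existsP; exists z; rewrite zL zy.
  exists (fun a => if a \in K then f1 a else f2 a).
    move=> a b aX bX; have fK c : c \in K -> f1 c \in rel_image r K.
      by move=> cK; rewrite inE; apply/existsP; exists c; rewrite cK f1r.
    have fnK c : c \in X -> c \notin K -> f2 c \notin rel_image r K.
      move=> cX cK; suff /andP[] : r c (f2 c) && (f2 c \notin rel_image r K) by [].
      by apply: f2r; rewrite inE cK.
    case: ifPn => aK; case: ifPn => bK; first exact: f1_inj.
    - by move=> fab; have := fK _ aK; rewrite fab (negbTE (fnK _ bX bK)).
    - by move=> fab; have := fK _ bK; rewrite -fab (negbTE (fnK _ aX aK)).
    - by apply: f2_inj; rewrite inE ?aK ?bK.
  move=> a aX; case: ifPn => aK; first exact: f1r.
  by have /andP[] : r a (f2 a) && (f2 a \notin rel_image r K) by apply: f2r; rewrite inE aK.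
have [y xy] : exists y, r x y.
  have := hallX [set x]; rewrite sub1set cards1 => /(_ xX)/card_gt0P[y].
  by rewrite inE => /existsP[z /andP[/set1P-> zy]]; exists y.
have [| |f f_inj fr] := IH (fun a b => r a b && (b != y)) (X :\ x).
- by rewrite (cardsD1 x) xX in Xm.
- move=> K /subsetD1P[KX xK]; have [->|K0] := eqVneq K set0; first by rewrite cards0.
  have KnX : K != X by apply: contraNneq xK => ->.
  have := tight K; rewrite KX K0 KnX /= -ltnNge.
  suff : #|rel_image r K| <= #|rel_image (fun a b => r a b && (b != y)) K| + 1 by lia.
  rewrite -[in X in _ <= X](cards1 y) addnC.
  apply: leq_trans (leq_card_setU _ _); apply/subset_leq_card/subsetP => z.
  rewrite !inE => /existsP[a /andP[aK az]]; have [//|zy /=] := eqVneq z y.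
  by apply/existsP; exists a; rewrite aK az.
have fy a : a \in X :\ x -> f a != y.
  by move=> aX; have /andP[] := fr a aX.
exists (fun a => if a == x then y else f a).
  move=> a b aX bX; case: eqVneq => [->|ax]; case: eqVneq => [->|bx] // fab.
  - by have := fy b; rewrite !inE bx bX -fab eqxx => /(_ isT).
  - by have := fy a; rewrite !inE ax aX fab eqxx => /(_ isT).
  - by apply: f_inj; rewrite ?inE ?ax ?bx.
move=> a aX; case: eqVneq => [->//|ax].
by have /andP[] : r a (f a) && (f a != y) by apply: fr; rewrite !inE ax.
Qed.

Lemma hall_perm r : (forall K, #|K| <= #|rel_image r K|) ->
  exists s : {perm T}, forall x, r x (s x).
Proof.
move=> hallr; have [K _|f f_inj fr] := @hall_injection r setT; first exact: hallr.
have inj : injective f by move=> a b; apply: f_inj.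
by exists (perm inj) => x; rewrite permE; apply: fr.
Qed.
End Hall.

(** These vertices index the zero rows, and those of [sources] the zero columns, of every
    realization. *)
Definition sinks n (E : digraph n) : {set 'I_n} := [set i | [forall j, (i, j) \notin E]].
Definition sources n (E : digraph n) : {set 'I_n} := [set j | [forall i, (i, j) \notin E]].

Definition converse n (E : digraph n) : digraph n := [set e | (e.2, e.1) \in E].

Lemma converseK n : involutive (@converse n).
Proof. by move=> E; apply/setP => -[i j]; rewrite !inE. Qed.

Lemma sinks_converse n (E : digraph n) : sinks (converse E) = sources E.
Proof. by apply/setP => i; rewrite !inE; apply: eq_forallb => j; rewrite inE. Qed.

Lemma sources_converse n (E : digraph n) : sources (converse E) = sinks E.
Proof. by apply/setP => i; rewrite !inE; apply: eq_forallb => j; rewrite inE. Qed.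

Section Violators.
Variables (n : nat).
Implicit Types (E : digraph n) (K S T : {set 'I_n}).

Definition outnbrs E K : {set 'I_n} := rel_image (fun i j => (i, j) \in E) K.

Lemma outnbrsP E K j : reflect (exists2 i, i \in K & (i, j) \in E) (j \in outnbrs E K).
Proof.
rewrite inE; apply: (iffP existsP) => [[i /andP[]]|[i iK ij]]; exists i => //.
by rewrite iK.
Qed.

(* S and T are the rows and columns that are matched with each other by decree. *)
Definition violator E S T K := [disjoint K & S] && (#|outnbrs E K :\: T| < #|K|).

(** Hall's theorem for the relation [r] that joins all of [S] to all of [T] and every other vertex
    to its out-neighbours outside [T]. *)
Lemma perm_or_violator E S T : #|S| = #|T| ->
  (exists2 s : {perm 'I_n}, forall i, (s i \in T) = (i \in S) &
     forall i, i \notin S -> (i, s i) \in E) \/ exists K, violator E S T K.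
Proof.
move=> ST; pose r i j := if i \in S then j \in T else (j \notin T) && ((i, j) \in E).
have [/existsP[K NK]|/existsPn hallr] := boolP [exists K, #|rel_image r K| < #|K|]; last first.
  left; have [|s sr] := @hall_perm _ r; first by move=> K; rewrite leqNgt hallr.
  exists s => i => [|/negbTE iS]; have := sr i; rewrite /r.
    by case: ifP => // _ /andP[/negbTE ->].
  by rewrite iS => /andP[].
right; exists (K :\: S); rewrite /violator disjoints_subset subDset setUCr subsetT /=.
have N1 : outnbrs E (K :\: S) :\: T \subset rel_image r K.
  apply/subsetP => j; rewrite inE => /andP[jT /outnbrsP[i]]; rewrite inE => /andP[iS iK] ij.
  by rewrite inE; apply/existsP; exists i; rewrite iK /r (negbTE iS) jT.
(* If [K] meets [S], its image contains [T]. Dropping [S] then costs the image at least [#|T|]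
   points and [K] at most [#|S| = #|T|], so the deficiency survives. *)
have [KS|[i]] := set_0Vmem (K :&: S).
  by rewrite -(cardsID S K) KS cards0 add0n in NK; apply: leq_ltn_trans NK; exact: subset_leq_card.
rewrite inE => /andP[iK iS].
have NT : T \subset rel_image r K.
  by apply/subsetP => j jT; rewrite inE; apply/existsP; exists i; rewrite iK /r iS.
have : #|T| + #|outnbrs E (K :\: S) :\: T| <= #|rel_image r K|.
  rewrite -(cardsID T (rel_image r K)) (setIidPr NT) leq_add2l.
  apply: subset_leq_card; rewrite subsetD N1 disjoints_subset.
  by apply/subsetP => j; rewrite !inE => /andP[].
move=> /leq_ltn_trans/(_ NK); rewrite -(cardsID S K) -ST.
move=> /leq_trans/(_ (leq_add (subset_leq_card (subsetIr K S)) (leqnn _))).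
by rewrite ltn_add2l.
Qed.

(** In a violator of least size, removing a vertex restores Hall's inequality. So the deficiency is
    exactly 1, and an out-neighbour reached from a single [x] would be lost with [x], leaving a
    smaller violator. *)
Lemma minimal_violator E S T K : violator E S T K ->
  exists K', [/\ violator E S T K', #|K'| <= #|K|, #|outnbrs E K' :\: T|.+1 = #|K'| &
    forall y, y \in outnbrs E K' :\: T -> 1 < #|[set x in K' | (x, y) \in E]|].
Proof.
move=> vK; have [K' vK' minK'] : exists2 K' : {set 'I_n}, violator E S T K' &
    forall J : {set 'I_n}, violator E S T J -> #|K'| <= #|J|.
  by case: (arg_minnP (fun K : {set 'I_n} => #|K|) vK) => K' ? ?; exists K'.
have /andP[dK' NK'] := vK'.
have small x : x \in K' -> #|K' :\ x| <= #|outnbrs E (K' :\ x) :\: T|.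
  move=> xK; rewrite leqNgt; apply/negP => ltx; have : violator E S T (K' :\ x).
    by rewrite /violator ltx andbT (disjointWl _ dK') ?subD1set.
  by move/minK'; rewrite (cardsD1 x K') xK; lia.
have sub x : outnbrs E (K' :\ x) \subset outnbrs E K'.
  apply/subsetP => y /outnbrsP[z /setD1P[_ zK] zy].
  by apply/outnbrsP; exists z.
have [x0 x0K] : exists x, x \in K' by apply/card_gt0P; apply: leq_ltn_trans NK'.
have sz : #|outnbrs E K' :\: T|.+1 = #|K'|.
  have := small _ x0K; have := subset_leq_card (setSD T (sub x0)).
  by have := cardsD1 x0 K'; rewrite x0K; lia.
exists K'; split => // [|y]; first exact: minK'.
rewrite inE => /andP[yT yN]; have /outnbrsP[x xK xy] := yN.
rewrite (cardsD1 x) inE xK xy add1n ltnS lt0n; apply/negP => /eqP/cards0_eq only.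
have : outnbrs E (K' :\ x) :\: T \subset (outnbrs E K' :\: T) :\ y.
  rewrite subsetD1 setSD ?sub//=; rewrite inE yT /=; apply/negP => /outnbrsP[z /setD1P[zx zK] zy].
  by have := in_set0 z; rewrite -only !inE zx zK zy.
move=> /subset_leq_card; have := small _ xK; have := cardsD1 x K'.
have := cardsD1 y (outnbrs E K' :\: T); rewrite xK inE yT yN /=.
move=> e1; rewrite -sz e1 add1n => /eqP; rewrite eqSS => /eqP <- le1.
by move=> /(leq_trans le1); rewrite ltnn.
Qed.

(* The set of columns that K misses violates the condition for the converse; its
   size is complementary to that of K, so one of the two is at most (n + 1) / 2. *)
Lemma violator_converse E S T K : #|S| = #|T| -> violator E S T K ->
  #|outnbrs E K :\: T|.+1 = #|K| ->
  violator (converse E) T S (~: (T :|: outnbrs E K)) /\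
  #|~: (T :|: outnbrs E K)| + #|K| <= n.+1.
Proof.
move=> ST /andP[dK NK] sz; set L := ~: _.
have cardL : #|L| + (#|T| + #|outnbrs E K :\: T|) = n.
  have -> : #|T| + #|outnbrs E K :\: T| = #|T :|: outnbrs E K|.
    by rewrite cardsU -(cardsID T (outnbrs E K)) setIC; lia.
  by rewrite addnC cardsC card_ord.
have cardSK : #|~: (S :|: K)| + (#|S| + #|K|) = n.
  have -> : #|S| + #|K| = #|S :|: K|.
    by rewrite cardsU setIC (disjoint_setI0 dK) cards0 subn0.
  by rewrite addnC cardsC card_ord.
split; last by lia.
apply/andP; split; first by rewrite disjoints_subset setCS subsetUl.
have : outnbrs (converse E) L :\: S \subset ~: (S :|: K).
  apply/subsetP => i; rewrite !in_setD in_setC in_setU => /andP[/negbTE-> /outnbrsP[j]].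
  rewrite !inE /= => /norP[_ jN] ij; apply: contra jN => iK.
  by apply/existsP; exists i; rewrite iK.
by move/subset_leq_card; lia.
Qed.

(* The two shapes of a smallest violator of Hall's condition off the sinks: a
   single vertex whose out-neighbours are all sinks, or a set K with #|K| - 1
   out-neighbours besides sinks, each of which has two in-neighbours in K. *)
Definition bad_single E :=
  exists i, i \notin sinks E /\ outnbrs E [set i] \subset sinks E.

Definition bad_cluster E := exists K N : {set 'I_n},
  [/\ [disjoint K & sinks E], 1 < #|K| /\ (#|K|).*2 <= n.+1, #|N| = #|K|.-1,
      outnbrs E K \subset N :|: sinks E & (#|K|.-1).*2 <= #|E :&: setX K N|].

Lemma card_edges_between E K N :
  #|E :&: setX K N| = \sum_(y in N) #|[set x in K | (x, y) \in E]|.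
Proof.
rewrite -sum1_card (partition_big snd (mem N)) /=; last by move=> [i j]; rewrite !inE => /and3P[].
apply: eq_bigr => y yN; rewrite sum1_card.
have pair_inj : injective (fun x : 'I_n => (x, y)) by move=> a b [].
rewrite -(card_imset (mem [set x in K | (x, y) \in E]) pair_inj).
apply: eq_card => -[a b]; apply/idP/imsetP => [|[x]].
  rewrite unfold_in /= !inE => /andP[/and3P[ab aK bN] /eqP by_].
  by exists a; rewrite -?by_ // !inE aK.
rewrite !inE => /andP[xK xy] [-> ->]; rewrite unfold_in /= !inE xy xK yN /=.
by rewrite eqxx.
Qed.

(** A source is nobody's out-neighbour, so discarding [T] from the out-neighbours discards only
    sinks. A minimal violator with one vertex is then a bad single, a larger one a bad cluster. *)
Lemma bad_of_violator E S T K : sinks E \subset S ->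
  T \subset sinks E :|: sources E -> (#|K|).*2 <= n.+1 ->
  violator E S T K -> bad_single E \/ bad_cluster E.
Proof.
move=> AS TZ Kn /minimal_violator[L [/andP[dL NL] LK sz two]].
have subN : outnbrs E L \subset (outnbrs E L :\: T) :|: sinks E.
  apply/subsetP => j jN; rewrite in_setU in_setD jN andbT.
  case: (boolP (j \in T)) => //= /(subsetP TZ); rewrite inE => /orP[//|].
  have /outnbrsP[i iL ij] := jN.
  by rewrite inE => /forallP/(_ i); rewrite ij.
have dA : [disjoint L & sinks E] by apply: disjointWr AS dL.
have [L1|L1] := leqP #|L| 1.
  left; have /cards1P[i Li] : #|L| == 1 by lia.
  exists i; move: subN sz; rewrite Li cards1 => subN [/cards0_eq N0].
  rewrite N0 set0U in subN; split => //.
  by rewrite -disjoints1 -Li.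
right; exists L, (outnbrs E L :\: T); split => //; first by split => //; lia.
  by rewrite -sz.
rewrite card_edges_between -sz /= -muln2 -sum_nat_const.
by apply: leq_sum => y; exact: two.
Qed.

Definition bad E := bad_single E \/ bad_cluster E.

(** The hypotheses are stable under passing to the converse, which exchanges sinks with sources and
    [S] with [T]; so a violator too large for [bad E] yields one small enough for
    [bad (converse E)]. *)
Lemma perm_of_not_bad E S T : ~ bad E -> ~ bad (converse E) ->
  sinks E \subset S -> S \subset sinks E :|: sources E ->
  sources E \subset T -> T \subset sinks E :|: sources E -> #|S| = #|T| ->
  exists2 s : {perm 'I_n}, forall i, (s i \in T) = (i \in S) &
     forall i, i \notin S -> (i, s i) \in E.
Proof.
move=> nb nbc AS SZ BT TZ ST; case: (perm_or_violator E ST) => // -[K0].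
move=> /minimal_violator[K [vK _ sz _]]; exfalso.
have [Kn|Kn] := leqP (#|K|).*2 n.+1; first exact: nb (bad_of_violator AS TZ Kn vK).
have [vL szL] := violator_converse ST vK sz.
apply: nbc; apply: (bad_of_violator _ _ _ vL); rewrite ?sinks_converse ?sources_converse//.
  by rewrite setUC.
by lia.
Qed.

End Violators.

Import Order.TTheory GRing.Theory Num.Theory.

Local Open Scope ring_scope.

(** * Matrices with separable annihilators *)

Lemma char_poly_conj (F : fieldType) n (Q A : 'M[F]_n) :
  Q \in unitmx -> char_poly (invmx Q *m A *m Q) = char_poly A.
Proof.
move=> uQ; rewrite /char_poly.
have -> : char_poly_mx (invmx Q *m A *m Q) =
    map_mx polyC (invmx Q) *m char_poly_mx A *m map_mx polyC Q.
  rewrite /char_poly_mx mulmxBr mulmxBl -!map_mxM; congr (_ - _).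
  by rewrite mul_mx_scalar -scalemxAl -map_mxM mulVmx// map_mx1 scale_scalar_mx mulr1.
rewrite !det_mulmx mulrAC -det_mulmx -map_mxM mulVmx//.
by rewrite map_mx1 det1 mul1r.
Qed.

(** The minimal polynomial divides [p], whose roots are simple. *)
Lemma diagonalizable_annihilated (F : closedFieldType) n (A : 'M[F]_n.+1) p :
  separable_poly p -> horner_mx A p = 0 -> diagonalizable A.
Proof.
move=> sp Ap; apply/diagonalizableP.
have [r pE] := closed_field_poly_normal p.
have p0 : p != 0.
  apply: contraTneq sp => ->.
  by rewrite unlock deriv0 coprimep0 -size_poly_eq1 size_poly0.
have l0 : lead_coef p != 0 by rewrite lead_coef_eq0.
exists r; last by have := mxminpoly_min Ap; rewrite pE dvdpZr.
rewrite -separable_prod_XsubC -(eqp_separable (eqp_scale _ l0)) -pE.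
exact: sp.
Qed.

Lemma mxrank_diagonalizable_sqr (F : fieldType) n (A : 'M[F]_n) :
  diagonalizable A -> (\rank A <= \rank (A *m A))%N.
Proof.
case=> P uP /(similar_diagLR uP)[d ->]; rewrite conjVmx//.
set X := invmx P *m _ *m P.
(* The inverse of 0 is 0, so [d * d * d^-1 = d] for every eigenvalue and [X] factors through its
   square. *)
have {1}-> : X = X *m X *m (invmx P *m diag_mx (map_mx (@GRing.inv F) d) *m P).
  rewrite /X !mulmxA !(mulmxK uP) -!(mulmxA (invmx P)) !mulmx_diag.
  congr (_ *m (diag_mx _ *m _)); apply/rowP => i; rewrite !mxE.
  have [->|d0] := eqVneq (d 0 i) 0; first by rewrite !mul0r.
  by rewrite mulfK.
exact: mxrankM_maxl.
Qed.

(* If [J M = M] and [M J = J N] then [q(M) J = J q(N)] for every [q]; take for [q]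
   the characteristic polynomial of [N]. *)
Lemma horner_mx_char_poly_intertwine (F : comNzRingType) n (M N J : 'M[F]_n.+1) :
  J * M = M -> M * J = J * N -> horner_mx M ('X * char_poly N) = 0.
Proof.
move=> JM MJ.
have qE q : horner_mx M q * J = J * horner_mx N q.
  elim/poly_ind: q => [|q c IH]; first by rewrite !rmorph0 mul0r mulr0.
  rewrite !rmorphD !rmorphM /= !horner_mx_X !horner_mx_C mulrDl mulrDr -mulrA.
  by rewrite MJ mulrA IH mulrA; congr (_ + _); apply/esym/scalar_mxC.
rewrite mulrC rmorphM /= horner_mx_X -{2}JM mulrA qE.
by rewrite (Cayley_Hamilton N) mulr0 mul0r.
Qed.

(** Mirror image of the preceding lemma, for zero columns instead of zero rows: here
    [J q(M) = q(N) J]. *)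
Lemma horner_mx_char_poly_intertwine_dual (F : comNzRingType) n (M N J : 'M[F]_n.+1) :
  M * J = M -> J * M = N * J -> horner_mx M ('X * char_poly N) = 0.
Proof.
move=> MJ JM.
have qE q : J * horner_mx M q = horner_mx N q * J.
  elim/poly_ind: q => [|q c IH]; first by rewrite !rmorph0 mul0r mulr0.
  rewrite !rmorphD !rmorphM /= !horner_mx_X !horner_mx_C mulrDl mulrDr mulrA.
  by rewrite IH -[_ * J * M]mulrA JM mulrA; congr (_ + _); exact: scalar_mxC.
rewrite rmorphM /= horner_mx_X -{1}MJ -mulrA qE.
by rewrite (Cayley_Hamilton N) mul0r mulr0.
Qed.

(** * Weighted permutation matrices with simple eigenvalues *)

Definition weighted_perm_mx (F : pzRingType) n (s : {perm 'I_n}) (r : 'I_n -> F) : 'M[F]_n :=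
  \matrix_(i, j) (r i *+ (s i == j)).

Section WeightedPerm.
Variables (F : closedFieldType) (n : nat) (s : {perm 'I_n.+1}) (r : 'I_n.+1 -> F).
Hypothesis rs : forall i, r (s i) = r i.
(* M ^+ #[s] is diagonal with entries r i ^+ #[s], so an eigenvector of M is
   supported on a single orbit of s. *)
Hypothesis r_inj : forall i j, r i ^+ #[s]%g = r j ^+ #[s]%g -> j \in porbit s i.
Hypothesis r0 : forall i, r i != 0.
Hypothesis char0 : (#[s]%g)%:R != 0 :> F.

Let M := weighted_perm_mx s r.
Let D : 'M[F]_n.+1 := diag_mx (\row_i r i).

Let ME : M = D *m perm_mx s.
Proof.
apply/matrixP => i j; rewrite mul_diag_mx !mxE.
by case: eqP => _; rewrite ?mulr1 ?mulr0.
Qed.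

Let DP : D *m perm_mx s = perm_mx s *m D.
Proof.
apply/matrixP => i j; rewrite mul_diag_mx mul_mx_diag !mxE.
by case: eqP => [<-|_]; rewrite ?mulr0 ?mul0r ?mulr1 ?mul1r ?rs.
Qed.

Let perm_mxX k : perm_mx s ^+ k = perm_mx (s ^+ k)%g :> 'M[F]_n.+1.
Proof.
elim: k => [|k IH]; first by rewrite expr0 expg0 perm_mx1.
by rewrite exprS expgS perm_mxM IH.
Qed.

(** [D] and the permutation matrix commute because [r] is constant on orbits, and the latter is
    annihilated by the separable polynomial ['X^#[s] - 1]; so the two are simultaneously
    diagonalizable. *)
Lemma diagonalizable_weighted_perm : diagonalizable M.
Proof.
suff [Q uQ /=/and3P[dD dP _]] : codiagonalizable [:: D; perm_mx s].
  have /(similar_diagLR uQ)[d1 E1] := dD; have /(similar_diagLR uQ)[d2 E2] := dP.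
  exists Q => //; apply/(similar_diagLR uQ).
  exists (\row_i (d1 0 i * d2 0 i)).
  by rewrite ME E1 E2 !conjVmx// -mulmx_diag !mulmxA (mulmxK uQ).
apply/codiagonalizableP; split.
  move=> f g; rewrite !inE => /orP[]/eqP-> /orP[]/eqP-> //; exact/esym.
move=> f; rewrite !inE => /orP[]/eqP->; first exact: diagonalizable_diag.
apply: (diagonalizable_annihilated (separable_Xn_sub_1 char0)).
rewrite rmorphB rmorph1 /= rmorphXn /= horner_mx_X perm_mxX expg_order perm_mx1.
by rewrite subrr.
Qed.

Let MN : M ^+ #[s]%g = diag_mx (\row_i r i ^+ #[s]%g).
Proof.
rewrite ME -[D *m _]/(D * _) exprMn_comm// perm_mxX expg_order perm_mx1 mulr1.
elim: #[s]%g => [|k IH].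
  by rewrite expr0; apply/matrixP => i j; rewrite !mxE expr0.
rewrite exprS IH -[D * _]/(D *m _) mulmx_diag; congr diag_mx.
by apply/rowP => i; rewrite !mxE exprS.
Qed.

Let eigenX (w : 'rV[F]_n.+1) z l :
  w *m M = z *: w -> w 0 l != 0 -> z ^+ #[s]%g = r l ^+ #[s]%g.
Proof.
move=> wM wl; have : w *m M ^+ #[s]%g = z ^+ #[s]%g *: w.
  elim: #[s]%g => [|m IH]; first by rewrite !expr0 mulmx1 scale1r.
  by rewrite !exprS mulmxA wM -scalemxAl IH scalerA.
by rewrite MN => /rowP/(_ l); rewrite mul_mx_diag !mxE mulrC => /(mulIf wl) ->.
Qed.

Let eigen_neq0 (w : 'rV[F]_n.+1) z l : w *m M = z *: w -> w 0 l != 0 -> z != 0.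
Proof.
move=> wM wl; apply: contraNneq (r0 l) => z0; have := eigenX wM wl.
rewrite z0 expr0n gtn_eqF ?order_gt0// => /esym/eqP.
by rewrite expf_eq0 => /andP[_].
Qed.

(** Eigenvectors for the same [z] are supported on the same orbit. Along it, [v *m M = z *: v] makes
    each coordinate of [v] a multiple of the preceding one, so the zero at [k] propagates. *)
Let eigen_simple (u v : 'rV[F]_n.+1) z k :
  u *m M = z *: u -> v *m M = z *: v -> u 0 k != 0 -> v 0 k = 0 -> v = 0.
Proof.
move=> uM vM uk vk; apply/rowP => l; rewrite mxE; apply/eqP/contraT => vl.
have /r_inj/porbitP[m lE] : r k ^+ #[s]%g = r l ^+ #[s]%g.
  by rewrite -(eigenX uM uk) -(eigenX vM vl).
suff E : v 0 l = 0 by rewrite E eqxx in vl.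
rewrite lE; elim: m {lE} => [|m IH]; first by rewrite expg0 perm1.
move: vM => /rowP/(_ ((s ^+ m.+1)%g k)).
rewrite !mxE (bigD1 ((s ^+ m)%g k))//= big1.
  rewrite IH mul0r add0r => /esym/eqP; rewrite mulf_eq0 (negbTE (eigen_neq0 uM uk)) /=.
  by move/eqP.
move=> i ik; rewrite !mxE expgSr permM (inj_eq perm_inj).
by rewrite (negbTE ik) mulr0n mulr0.
Qed.

(** The rows of [Q] are independent eigenvectors with eigenvalues [d]. None is 0, and a repeated one
    would allow a combination of two rows vanishing at a coordinate where the first does not, hence
    0 by [eigen_simple]. *)
Lemma separable_weighted_perm : separable_poly ('X * char_poly M).
Proof.
have [Q uQ /(similar_diagLR uQ)[d]] := diagonalizable_weighted_perm.
rewrite conjVmx// => Md.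
have eig i : row i Q *m M = d 0 i *: row i Q.
  by rewrite Md !mulmxA -row_mul mulmxV// row1 -rowE row_diag_mx -scalemxAl -rowE.
have row_neq0 i : exists k, row i Q 0 k != 0.
  apply/rV0Pn; apply: contraTneq uQ => Q0; rewrite unitmxE.
  rewrite (expand_det_row _ i) big1 ?unitr0// => j _.
  by move/rowP/(_ j): Q0; rewrite !mxE => ->; rewrite mul0r.
rewrite Md char_poly_conj// char_poly_trig ?diag_mx_is_trig//.
have -> : 'X * \prod_i ('X - (diag_mx d i i)%:P) =
    \prod_(a <- 0 :: [seq d 0 i | i <- enum 'I_n.+1]) ('X - a%:P).
  rewrite big_cons subr0 big_map big_enum; congr (_ * _); apply: eq_bigr => i _.
  by rewrite mxE eqxx mulr1n.
rewrite separable_prod_XsubC /=; apply/andP; split.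
  apply/mapP => -[i _ di]; have [k ik] := row_neq0 i.
  by have := eigen_neq0 (eig i) ik; rewrite -di eqxx.
rewrite map_inj_uniq ?enum_uniq// => i j dij; apply/eqP/contraT => ij.
have [k ik] := row_neq0 i; pose a := row j Q 0 k / row i Q 0 k.
have /(eigen_simple (eig i))/(_ ik) :
    (row j Q - a *: row i Q) *m M = d 0 i *: (row j Q - a *: row i Q).
  by rewrite mulmxBl -scalemxAl !eig dij scalerBr !scalerA mulrC.
have -> : (row j Q - a *: row i Q) 0 k = 0.
  by move: ik; rewrite /a !mxE => ik; rewrite divfK// subrr.
move=> /(_ erefl) ji.
have : (row j Q - a *: row i Q) *m invmx Q = 0 by rewrite ji mul0mx.
rewrite mulmxBl -scalemxAl -!row_mul mulmxV// => /rowP/(_ j).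
rewrite !mxE eqxx (negbTE ij) mulr0 subr0 => /eqP.
by rewrite oner_eq0.
Qed.
End WeightedPerm.

From mathcomp Require Import all_classical all_reals all_analysis.
From mathcomp Require Import complex measurable_realfun.
From mathcomp Require Import(canonicals) mpoly.

Import numFieldNormedType.Exports.

(** * The random digraph *)

Section SubsetSums.
Variables (R : comNzRingType) (T : finType).

Lemma sum_exp_card_set (x : R) : \sum_(I : {set T}) x ^+ #|I| = (1 + x) ^+ #|T|.
Proof.
rewrite -prodr_const addrC bigA_distr /=; apply: eq_bigr => I _.
by rewrite -prodr_const [LHS]big_mkcond.
Qed.

(** Inclusion-exclusion, by expanding the product of [1 - [i \in A]] over all [i]. *)
Lemma natr_eq_set0 (A : {set T}) :
  (A == finset.set0)%:R = \sum_(I : {set T}) (-1) ^+ #|I| * (I \subset A)%:R :> R.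
Proof.
have -> : (A == finset.set0)%:R = \prod_(i : T) (- (i \in A)%:R + 1) :> R.
  have [->|[i iA]] := set_0Vmem A.
    by rewrite eqxx big1// => i _; rewrite finset.in_set0 oppr0 add0r.
  rewrite (bigD1 i)//= iA addNr mul0r.
  by case: eqVneq iA => // ->; rewrite finset.in_set0.
rewrite bigA_distr /=; apply: eq_bigr => I _.
have [IA|/fintype.subsetPn[i iI iA]] := boolP (I \subset A); last first.
  by rewrite mulr0 (bigD1 i)//= iI (negbTE iA) oppr0 mul0r.
rewrite mulr1 -prodr_const [RHS]big_mkcond; apply: eq_bigr => i _.
by case: ifP => // /(fintype.subsetP IA) ->.
Qed.

Lemma sum_card_set (f : nat -> R) :
  \sum_(I : {set T}) f #|I| = \sum_(k < #|T|.+1) 'C(#|T|, k)%:R * f k.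
Proof.
rewrite (partition_big (fun I : {set T} => inord #|I| : 'I_#|T|.+1) predT)//=.
apply: eq_bigr => k _; rewrite (eq_bigl (fun I : {set T} => #|I| == k)); last first.
  by move=> I; rewrite -val_eqE /= inordK// ltnS max_card.
rewrite (eq_bigr (fun=> f k)) => [|I /eqP-> //].
by rewrite sumr_const mulr_natl -[in RHS](card_draws T k) cardsE.
Qed.

End SubsetSums.

Section Gnp.
Variables (R : realType) (n : nat) (p : R).
Hypothesis p01 : 0 <= p <= 1.
Implicit Types (Q : digraph n -> Prop) (D S E : digraph n).
Local Notation q := (1 - p).
Local Notation P := (@gnp_prob R n p).

Let p0 : 0 <= p. Proof. by case/andP: p01. Qed.
Let q0 : 0 <= q. Proof. by rewrite subr_ge0; case/andP: p01. Qed.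

Lemma gnp_mass_ge0 E : 0 <= gnp_mass p E.
Proof. by apply: prodr_ge0 => e _; case: ifP. Qed.

Lemma gnp_probE Q : P Q = \sum_(E : digraph n) gnp_mass p E * `[< Q E >]%:R.
Proof.
rewrite /gnp_prob big_mkcond; apply: eq_bigr => E _.
by case: ifP; rewrite ?mulr1 ?mulr0.
Qed.

Lemma gnp_prob_ge0 Q : 0 <= P Q.
Proof. by apply: sumr_ge0 => E _; exact: gnp_mass_ge0. Qed.

Lemma gnp_prob_le Q1 Q2 : (forall E, Q1 E -> Q2 E) -> P Q1 <= P Q2.
Proof.
move=> Q12; rewrite !gnp_probE; apply: ler_sum => E _.
rewrite ler_wpM2l ?gnp_mass_ge0// ler_nat.
by case: (asboolP (Q1 E)) => // /Q12/asboolT ->.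
Qed.

Lemma gnp_prob_eq Q1 Q2 : (forall E, Q1 E <-> Q2 E) -> P Q1 = P Q2.
Proof. by move=> Q12; apply: le_anti; rewrite !gnp_prob_le// => E /Q12. Qed.

Lemma gnp_prob_exists (I : finType) (Q : I -> digraph n -> Prop) :
  P (fun E => exists i, Q i E) <= \sum_i P (Q i).
Proof.
rewrite gnp_probE (eq_bigr _ (fun i _ => gnp_probE (Q i))) exchange_big /=.
apply: ler_sum => E _; rewrite -mulr_sumr ler_wpM2l ?gnp_mass_ge0//.
case: asboolP => [[i /asboolT QE]|_]; last by apply: sumr_ge0.
by rewrite (bigD1 i)//= QE lerDl; apply: sumr_ge0.
Qed.

Lemma gnp_probD Q1 Q2 :
  P (fun E => Q1 E \/ Q2 E) = P Q1 + P Q2 - P (fun E => Q1 E /\ Q2 E).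
Proof.
rewrite !gnp_probE -big_split /= -sumrB; apply: eq_bigr => E _.
rewrite -mulrDr -mulrBr asbool_or asbool_and.
by case: asboolP; case: asboolP => _ _ /=; ring.
Qed.

Lemma gnp_prob_or_le Q1 Q2 : P (fun E => Q1 E \/ Q2 E) <= P Q1 + P Q2.
Proof. by rewrite gnp_probD gerBl gnp_prob_ge0. Qed.

Lemma gnp_prob_dist W Q1 Q2 : (forall E, ~ W E -> (Q1 E <-> Q2 E)) ->
  `|P Q1 - P Q2| <= P W.
Proof.
have half Q Q' : (forall E, ~ W E -> Q E -> Q' E) -> P Q - P Q' <= P W.
  move=> QQ'; rewrite lerBlDl; apply: le_trans (gnp_prob_or_le _ _).
  apply: gnp_prob_le => E QE; have [WE|nW] := pselect (W E); [by right|left].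
  exact: QQ'.
move=> Q12; rewrite ler_norml lerNl opprB.
by apply/andP; split; apply: half => E /Q12 [].
Qed.

(** The sum over all digraphs factors over the pairs: a pair of [D] contributes [p], a pair of [S]
    contributes [q], any other [p + q = 1]. *)
Lemma gnp_prob_in_out D S : [disjoint D & S]%bool ->
  P (fun E => D \subset E /\ [disjoint S & E]%bool) = p ^+ #|D| * q ^+ #|S|.
Proof.
move=> DS; transitivity (\prod_(e : 'I_n * 'I_n)
    ((if e \in S then 0 else p) + (if e \in D then 0 else q))); last first.
  rewrite -!prodr_const [X in X * _]big_mkcond [X in _ * X]big_mkcond -big_split /=.
  apply: eq_bigr => e _; have [eS|_] := boolP (e \in S).
    by rewrite (disjointFl DS eS) add0r mul1r.
  by case: ifP => _; rewrite ?addr0 ?mulr1// subrKC.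
rewrite bigA_distr gnp_probE; apply: eq_bigr => E _.
have [[/fintype.subsetP DE SE]|nE] := asboolP.
  rewrite mulr1; apply: eq_bigr => e _; case: ifP => eE.
    by rewrite (disjointFl SE eE).
  by case: ifP => // /DE; rewrite eE.
rewrite mulr0; apply/esym/eqP; rewrite prodf_seq_eq0; apply/hasP.
have [/fintype.subsetPn[e eD eE]|/negbNE DE] := boolP (~~ (D \subset E)).
  by exists e; rewrite ?mem_index_enum//= (negbTE eE) eD.
have [SE|] := boolP [disjoint S & E]%bool; first by case: nE.
rewrite -setI_eq0 => /set0Pn[e]; rewrite inE => /andP[eS eE].
by exists e; rewrite ?mem_index_enum//= eE eS.
Qed.

Lemma gnp_prob_out S : P (fun E => [disjoint S & E]%bool) = q ^+ #|S|.
Proof.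
have := @gnp_prob_in_out finset.set0 S; rewrite cards0 expr0 mul1r => <-.
  by apply: gnp_prob_eq => E; rewrite finset.sub0set; split=> [|[]].
by rewrite -setI_eq0 finset.set0I.
Qed.

Lemma gnp_prob_converse Q : P (fun E => Q (converse E)) = P Q.
Proof.
rewrite !gnp_probE [RHS](reindex_inj (inv_inj (@converseK n))) /=.
apply: eq_bigr => E _; congr (_ * _).
have swap_inj : injective (fun e : 'I_n * 'I_n => (e.2, e.1)).
  by move=> [a b] [c d] [-> ->].
rewrite /gnp_mass (reindex_inj swap_inj); apply: eq_bigr => e _.
by case: e => i j; rewrite inE.
Qed.

End Gnp.

Lemma subset_sinks n (E : digraph n) (I : {set 'I_n}) :
  (I \subset sinks E) = [disjoint finset.setX I [set: 'I_n] & E]%bool.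
Proof.
rewrite -setI_eq0; apply/fintype.subsetP/eqP => [IE|IE i iI].
  apply/finset.setP => -[i j]; rewrite !inE andbT; apply/negP => /andP[/IE].
  by rewrite inE => /forallP/(_ j)/negP.
rewrite inE; apply/forallP => j; apply/negP => ij.
by have := finset.in_set0 (i, j); rewrite -IE !inE iI ij.
Qed.

Lemma subset_sources n (E : digraph n) (J : {set 'I_n}) :
  (J \subset sources E) = [disjoint finset.setX [set: 'I_n] J & E]%bool.
Proof.
rewrite -setI_eq0; apply/fintype.subsetP/eqP => [IE|IE j jJ].
  apply/finset.setP => -[i j]; rewrite !inE; apply/negP => /andP[/IE].
  by rewrite inE => /forallP/(_ i)/negP.
rewrite inE; apply/forallP => i; apply/negP => ij.
by have := finset.in_set0 (i, j); rewrite -IE !inE jJ ij.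
Qed.

Lemma card_cross n (I J : {set 'I_n}) :
  #|finset.setX I [set: 'I_n] :|: finset.setX [set: 'I_n] J| =
  (n * #|J| + #|I| * (n - #|J|))%N.
Proof.
rewrite cardsU !cardsX cardsT card_ord.
have -> : finset.setX I [set: 'I_n] :&: finset.setX [set: 'I_n] J = finset.setX I J.
  by apply/finset.setP => -[i j]; rewrite !inE andbT.
have := subset_leq_card (finset.subsetT J); rewrite cardsX cardsT card_ord => Jn.
by rewrite mulnBr addnBA ?leq_mul// addnC.
Qed.

Lemma ler_subX (R : realFieldType) (a b : R) n : 0 <= b <= a -> a <= 1 ->
  a ^+ n - b ^+ n <= n%:R * (a - b).
Proof.
move=> /andP[b0 ba] a1; have a0 := le_trans b0 ba.
rewrite subrXX mulrC ler_wpM2r ?subr_ge0//.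
have -> : n%:R = \sum_(i < n) (1 : R) by rewrite sumr_const card_ord.
by apply: ler_sum => i _; rewrite mulr_ile1 ?exprn_ge0 ?exprn_ile1// (le_trans ba).
Qed.

Section Gnp.
Variables (R : realType) (n : nat) (p : R).
Hypothesis p01 : 0 <= p <= 1.
Implicit Types (Q : digraph n -> Prop) (D S E : digraph n).
Local Notation q := (1 - p).
Local Notation P := (@gnp_prob R n p).

Let p0 : 0 <= p. Proof. by case/andP: p01. Qed.
Let q0 : 0 <= q. Proof. by rewrite subr_ge0; case/andP: p01. Qed.
Let q1 : q <= 1. Proof. by rewrite gerBl. Qed.

(** The rows are independent and each is nonempty with probability [1 - q ^+ n]. This is derived by
    inclusion-exclusion over a set [I] of empty rows, summed by the binomial theorem. *)
Lemma gnp_prob_no_sink : P (fun E => sinks E = finset.set0) = (1 - q ^+ n) ^+ n.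
Proof.
rewrite -[X in _ ^+ X]card_ord -sum_exp_card_set gnp_probE.
transitivity (\sum_(E : digraph n) gnp_mass p E *
    \sum_(I : {set 'I_n}) (-1) ^+ #|I| * (I \subset sinks E)%:R).
  apply: eq_bigr => E _; rewrite -natr_eq_set0; congr (_ * (nat_of_bool _)%:R).
  by apply/asboolP/eqP.
under eq_bigr do rewrite mulr_sumr.
rewrite exchange_big /=; apply: eq_bigr => I _.
under eq_bigr do rewrite mulrCA.
rewrite -mulr_sumr [RHS]exprNn; congr (_ * _).
transitivity (P (fun E => [disjoint finset.setX I [set: 'I_n] & E]%bool)).
  by rewrite gnp_probE; apply: eq_bigr => E _; rewrite asboolb subset_sinks.
by rewrite (gnp_prob_out p01) cardsX cardsT card_ord exprM -!exprM mulnC.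
Qed.

Lemma gnp_prob_no_source : P (fun E => sources E = finset.set0) = (1 - q ^+ n) ^+ n.
Proof.
rewrite -gnp_prob_no_sink -[RHS]gnp_prob_converse.
by apply: (gnp_prob_eq p01) => E; rewrite sinks_converse.
Qed.

(** Inclusion-exclusion over a set [J] of empty columns and a set [I] of empty rows. Each row of [I]
    excludes [n - #|J|] further pairs, so the sum over [I] is again a binomial expansion. *)
Lemma gnp_prob_no_sink_source :
  P (fun E => sinks E = finset.set0 /\ sources E = finset.set0) =
  \sum_(J : {set 'I_n}) (- q ^+ n) ^+ #|J| * (1 - q ^+ (n - #|J|)) ^+ n.
Proof.
rewrite gnp_probE.
transitivity (\sum_(E : digraph n) gnp_mass p E *
    \sum_(J : {set 'I_n}) \sum_(I : {set 'I_n}) (-1) ^+ #|J| * (J \subset sources E)%:R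
       * ((-1) ^+ #|I| * (I \subset sinks E)%:R)).
  apply: eq_bigr => E _; under eq_bigr do rewrite -mulr_sumr.
  rewrite -mulr_suml -!natr_eq_set0 -natrM mulnb asbool_and andbC; congr (_ * (_ && _)%:R).
    by apply/asboolP/eqP.
  by apply/asboolP/eqP.
under eq_bigr do rewrite mulr_sumr.
rewrite exchange_big /=; apply: eq_bigr => J _.
under eq_bigr do rewrite mulr_sumr.
rewrite exchange_big /= -[X in _ * _ ^+ X]card_ord -sum_exp_card_set mulr_sumr.
apply: eq_bigr => I _.
transitivity ((-1) ^+ #|J| * (-1) ^+ #|I| * P (fun E =>
   [disjoint finset.setX I [set: 'I_n] :|: finset.setX [set: 'I_n] J & E]%bool)).
  rewrite gnp_probE mulr_sumr; apply: eq_bigr => E _.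
  rewrite asboolb subset_sinks subset_sources.
  have -> : [disjoint finset.setX I [set: 'I_n] :|: finset.setX [set: 'I_n] J & E]%bool =
     [disjoint finset.setX [set: 'I_n] J & E]%bool && [disjoint finset.setX I [set: 'I_n] & E]%bool.
    by rewrite -!setI_eq0 finset.setIUl finset.setU_eq0 andbC.
  by rewrite -mulnb natrM; ring.
rewrite (gnp_prob_out p01) card_cross exprD !exprM.
rewrite [in RHS]exprNn [X in _ = _ * X]exprNn -!exprM.
by rewrite (mulnC #|I|); ring.
Qed.

(* Only the columns are treated by inclusion-exclusion; if the columns of J are
   empty, the rows are independent and nonempty with probability 1 - q ^ (n - #|J|). *)
Lemma gnp_prob_no_sink_source_dist : (0 < n)%N ->
  `|P (fun E => sinks E = finset.set0 /\ sources E = finset.set0) - (1 - q ^+ n) ^+ (n + n)|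
  <= n%:R * q ^+ n * ((1 + q ^+ n.-1) ^+ n - (1 + q ^+ n) ^+ n).
Proof.
move=> n0; rewrite gnp_prob_no_sink_source exprD.
(* One factor of the limit term and both powers in the bound are expanded over [J] as well, and the
   comparison is made term by term. *)
rewrite -[X in _ - (_ ^+ X) * _]card_ord -sum_exp_card_set mulr_suml -sumrB.
rewrite -[X in _ * (_ ^+ X - _)]card_ord -[X in _ * (_ - _ ^+ X)]card_ord.
rewrite -!sum_exp_card_set -sumrB mulr_sumr.
apply: le_trans (ler_norm_sum _ _ _) _; apply: ler_sum => J _.
have Jn : (#|J| <= n)%N by rewrite -[X in (_ <= X)%N]card_ord max_card.
rewrite -mulrBr normrM normrX normrN (ger0_norm (exprn_ge0 _ q0)) distrC ger0_norm.
  apply: le_trans (ler_wpM2l _ (ler_subX _ _ _)) _.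
  - by rewrite exprn_ge0// exprn_ge0.
  - rewrite subr_ge0 exprn_ile1//= lerD2l lerN2.
    by rewrite ler_wiXn2l// leq_subr.
  - by rewrite gerBl exprn_ge0.
  (* Now both sides agree: [q^(n|J|) (q^(n-|J|) - q^n) = q^n (q^((n-1)|J|) - q^(n|J|))]. *)
  rewrite le_eqVlt; apply/orP; left; apply/eqP.
  have -> : 1 - q ^+ n - (1 - q ^+ (n - #|J|)) = q ^+ (n - #|J|) - q ^+ n by ring.
  rewrite -!exprM !(mulrBr, mulrCA _ n%:R); congr (_ - _); last by ring.
  rewrite -mulrA -!exprD; congr (_ * _ ^+ _).
  have -> : (n * #|J| = n.-1 * #|J| + #|J|)%N by rewrite -mulSnr prednK.
  by rewrite -addnA subnKC// addnC.
rewrite subr_ge0 lerXn2r ?nnegrE ?subr_ge0 ?exprn_ile1//.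
by rewrite lerD2l lerN2 ler_wiXn2l// leq_subr.
Qed.

(** Union bound over a vertex [v] with empty row and column, [2n - 1] absent pairs. *)
Lemma gnp_prob_sink_source_meet : (0 < n)%N ->
  P (fun E => sinks E :&: sources E <> finset.set0) <= n%:R * (q ^+ n * q ^+ n.-1).
Proof.
move=> n0; apply: (@le_trans _ _ (P (fun E => exists v : 'I_n,
    [disjoint finset.setX [set v] [set: 'I_n] :|: finset.setX [set: 'I_n] [set v] & E]%bool))).
  apply: gnp_prob_le => // E /eqP/set0Pn[v]; rewrite inE => /andP[vA vB]; exists v.
  rewrite -setI_eq0 finset.setIUl finset.setU_eq0 !setI_eq0.
  by rewrite -subset_sinks -subset_sources !finset.sub1set vA.
apply: le_trans (gnp_prob_exists _ _) _ => //.
under eq_bigr do rewrite (gnp_prob_out p01) card_cross cards1.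
by rewrite sumr_const card_ord muln1 mul1n subn1 exprD mulr_natl.
Qed.

End Gnp.

(** * Union bounds for bad singles and bad clusters *)

Lemma subset_of_card (T : finType) (A : {set T}) m : (m <= #|A|)%N ->
  exists2 B : {set T}, B \subset A & #|B| = m.
Proof.
rewrite -bin_gt0 -cards_draws => /card_gt0P[B]; rewrite inE => /andP[BA /eqP Bm].
by exists B.
Qed.

Section Gnp.
Variables (R : realType) (n : nat) (p : R).
Hypothesis p01 : 0 <= p <= 1.
Local Notation q := (1 - p).
Local Notation P := (@gnp_prob R n p).

Let p0 : 0 <= p. Proof. by case/andP: p01. Qed.
Let q0 : 0 <= q. Proof. by rewrite subr_ge0; case/andP: p01. Qed.
Let q1 : q <= 1. Proof. by rewrite gerBl. Qed.

Lemma gnp_prob_false (Q : digraph n -> Prop) : (forall E, ~ Q E) -> P Q = 0.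
Proof. by move=> nQ; rewrite /gnp_prob big1// => E /asboolP /nQ. Qed.

(** Union bound over the set [A] of sinks, the vertex [i] and an edge from [i] to some [a] in [A].
    The rows of [A] and the pairs from [i] to [~: A] are absent, [n + n.-1 * #|A|] pairs in all. *)
Lemma gnp_prob_bad_single : (0 < n)%N ->
  P (@bad_single n) <= n%:R * p * q ^+ n * (1 + 2 * q ^+ n.-1) ^+ n.
Proof.
move=> n0.
pose S (A : {set 'I_n}) i := finset.setX A [set: 'I_n] :|: finset.setX [set i] (~: A).
pose Q (A : {set 'I_n}) i (a : 'I_n) (E : digraph n) :=
  [/\ i \notin A, a \in A & [set (i, a)] \subset E /\ [disjoint S A i & E]%bool].
apply: (@le_trans _ _ (P (fun E => exists A, exists i, exists a, Q A i a E))).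
  apply: gnp_prob_le => // E [i [iA out]]; exists (sinks E), i.
  have [a ia] : exists a, (i, a) \in E.
    by move: iA; rewrite inE => /forallPn[a]; rewrite negbK; exists a.
  have aA : a \in sinks E by apply: (fintype.subsetP out); apply/outnbrsP; exists i; rewrite ?inE.
  exists a; split; rewrite ?finset.sub1set//; split => //.
  rewrite -setI_eq0 finset.setIUl finset.setU_eq0 !setI_eq0 -subset_sinks subxx /=.
  rewrite -setI_eq0; apply/eqP/finset.setP => -[x y]; rewrite !inE /=.
  apply/negP => /andP[/andP[/eqP-> yA] iy]; move/negP: yA; apply.
  have : y \in outnbrs E [set i] by apply/outnbrsP; exists i; rewrite ?inE.
  by move/(fintype.subsetP out); rewrite inE.
apply: le_trans (gnp_prob_exists p01 _) _.
have -> : n%:R * p * q ^+ n * (1 + 2 * q ^+ n.-1) ^+ n =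
    \sum_(A : {set 'I_n}) n%:R * p * q ^+ n * (2 * q ^+ n.-1) ^+ #|A|.
  by rewrite -mulr_sumr sum_exp_card_set card_ord.
apply: ler_sum => A _; apply: le_trans (gnp_prob_exists p01 _) _.
rewrite -!mulrA mulr_natl -[X in _ *+ X]card_ord -sumr_const; apply: ler_sum => i _.
apply: le_trans (gnp_prob_exists p01 _) _.
apply: (@le_trans _ _ (\sum_(a in A) p * (q ^+ n * q ^+ n.-1 ^+ #|A|))).
  rewrite [leRHS]big_mkcond; apply: ler_sum => a _.
  have [aA|aA] := boolP (a \in A); last by rewrite gnp_prob_false// => E [_]; rewrite (negbTE aA).
  have [iA|iA] := boolP (i \in A).
    by rewrite gnp_prob_false ?mulr_ge0 ?exprn_ge0// => E []; rewrite iA.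
  apply: (@le_trans _ _ (P (fun E => [set (i, a)] \subset E /\ [disjoint S A i & E]%bool))).
    by apply: gnp_prob_le => // E [].
  rewrite gnp_prob_in_out; last first.
    by rewrite disjoints1 !inE /= (negbTE iA) aA andbF.
  rewrite cards1 expr1 -exprM -exprD ler_wpM2l// ler_wiXn2l//.
  rewrite cardsU !cardsX cards1 mul1n cardsT card_ord.
  have -> : finset.setX A [set: 'I_n] :&: finset.setX [set i] (~: A) = finset.set0.
    apply/finset.setP => -[x y]; rewrite !inE /= andbT.
    by case: (eqVneq x i) => [->|]; rewrite ?(negbTE iA) ?andbF.
  rewrite cards0 subn0 -[X in (X + _ <= _)%N](card_ord n) -(cardsC A).
  have -> : (#|A| * n = n.-1 * #|A| + #|A|)%N by rewrite -mulSnr prednK// mulnC.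
  by rewrite addnC addnA.
(* The [#|A|] choices of [a] are bounded by [2 ^ #|A|], so that the sum over [A] becomes a power;
   hence the factor 2. *)
rewrite sumr_const -[X in X <= _]mulr_natl exprMn.
rewrite mulrCA ler_wpM2l// mulrCA ler_wpM2l ?exprn_ge0// ler_wpM2r ?exprn_ge0//.
by rewrite -natrX ler_nat ltnW// ltn_expl.
Qed.

(** Bounds the expected number of bad clusters on a given [K] of size [k]. The factors count the
    sets [N], count the sets of [k.-1.*2] edges from [K] to [N], give the probability of these
    edges, and account for the absent pairs; the last one sums over all possible sets of sinks. *)
Definition cluster_term k : R :=
  'C(n, k.-1)%:R * 'C(k * k.-1, k.-1.*2)%:R * p ^+ k.-1.*2 *
  q ^+ (k * (n - k.-1)) * (1 + q ^+ (n - k)) ^+ n.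

(** Union bound over [K], [N], the set [A] of sinks and a set [D] of exactly [k.-1.*2] edges from
    [K] to [N]. *)
Lemma gnp_prob_bad_cluster :
  P (@bad_cluster n) <=
  \sum_(k < n.+1 | (1 < k)%N && (k.*2 <= n.+1)%N) 'C(n, k)%:R * cluster_term k.
Proof.
pose C (K : {set 'I_n}) := (1 < #|K|)%N && ((#|K|).*2 <= n.+1)%N.
pose S (A K N : {set 'I_n}) : digraph n :=
  finset.setX A [set: 'I_n] :|: finset.setX K (~: (N :|: A)).
pose Q (K N A : {set 'I_n}) (D E : digraph n) :=
  [/\ C K, #|N| == #|K|.-1, [disjoint K & A]%bool,
    (D \subset finset.setX K N) && (#|D| == (#|K|.-1).*2) &
    D \subset E /\ [disjoint S A K N & E]%bool].
apply: (@le_trans _ _ (P (fun E => exists K, exists N, exists A, exists D, Q K N A D E))).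
  apply: gnp_prob_le => // E [K [N [dK [K1 K2] NK out many]]].
  have [D DE Dk] := subset_of_card many; exists K, N, (sinks E), D.
  move: DE; rewrite finset.subsetI => /andP[DE DKN].
  split; rewrite /C ?K1 ?NK// ?DKN ?Dk ?eqxx//; split => //.
  rewrite -setI_eq0 finset.setIUl finset.setU_eq0 !setI_eq0 -subset_sinks subxx /=.
  rewrite -setI_eq0; apply/eqP/finset.setP => -[x y]; rewrite !inE /=.
  apply/negP => /andP[/andP[xK /norP[yN yA]] xy].
  have : y \in outnbrs E K by apply/outnbrsP; exists x.
  by move/(fintype.subsetP out); rewrite !inE (negbTE yN) (negbTE yA).
apply: le_trans (gnp_prob_exists p01 _) _.
pose G k := if (1 < k)%N && (k.*2 <= n.+1)%N then cluster_term k else 0.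
have -> : \sum_(k < n.+1 | (1 < k)%N && (k.*2 <= n.+1)%N) 'C(n, k)%:R * cluster_term k =
   \sum_(K : {set 'I_n}) G #|K|.
  rewrite sum_card_set big_mkcond card_ord; apply: eq_bigr => k _.
  by rewrite /G; case: ifP; rewrite ?mulr0.
apply: ler_sum => K _; rewrite /G; have [CK|CK] := boolP (_ && _); last first.
  by rewrite gnp_prob_false// => E [N [A [D []]]]; rewrite /C (negbTE CK).
set k := #|K| in CK *.
apply: le_trans (gnp_prob_exists p01 _) _.
have -> : cluster_term k = \sum_(N : {set 'I_n} | #|N| == k.-1)
    ('C(k * k.-1, k.-1.*2)%:R * p ^+ k.-1.*2 * q ^+ (k * (n - k.-1)) * (1 + q ^+ (n - k)) ^+ n).
  rewrite sumr_const /cluster_term -!mulrA mulr_natl; congr (_ *+ _).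
  by rewrite -[in LHS](card_ord n) -card_draws cardsE.
rewrite [leRHS]big_mkcond; apply: ler_sum => N _; case: ifPn => NK; last first.
  by rewrite gnp_prob_false// => E [A [D []]]; rewrite (negbTE NK).
apply: le_trans (gnp_prob_exists p01 _) _.
have -> : (1 + q ^+ (n - k)) ^+ n = \sum_(A : {set 'I_n}) q ^+ (n - k) ^+ #|A|.
  by rewrite sum_exp_card_set card_ord.
rewrite mulr_sumr.
apply: ler_sum => A _; apply: le_trans (gnp_prob_exists p01 _) _.
apply: (@le_trans _ _ (\sum_(D : digraph n | (D \subset finset.setX K N) && (#|D| == k.-1.*2))
    (p ^+ k.-1.*2 * q ^+ (k * (n - k.-1)) * q ^+ (n - k) ^+ #|A|))); last first.
  rewrite (eq_bigl (fun D => D \in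
    [set D : digraph n | D \subset finset.setX K N & #|D| == k.-1.*2])).
    by rewrite sumr_const cards_draws cardsX (eqP NK) -!mulrA mulr_natl.
  by move=> D; rewrite inE.
rewrite [leRHS]big_mkcond; apply: ler_sum => D _; case: ifPn => DK; last first.
  by rewrite gnp_prob_false// => E [_ _ _]; rewrite (negbTE DK).
have [dK|dK] := boolP [disjoint K & A]%bool; last first.
  by rewrite gnp_prob_false ?mulr_ge0 ?exprn_ge0// => E [_ _]; rewrite (negbTE dK).
apply: (@le_trans _ _ (P (fun E => D \subset E /\ [disjoint S A K N & E]%bool))).
  by apply: gnp_prob_le => // E [].
have /andP[DKN /eqP Dk] := DK.
rewrite gnp_prob_in_out; last first.
  apply: (fintype.disjointWl DKN); rewrite -setI_eq0; apply/eqP/finset.setP => -[x y].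
  rewrite !inE /= andbT; apply/negP => /andP[/andP[xK yN]].
  by rewrite (disjointFr dK xK) yN xK.
rewrite Dk -mulrA ler_wpM2l ?exprn_ge0// -exprM -exprD ler_wiXn2l//.
rewrite cardsU !cardsX cardsT card_ord.
have -> : finset.setX A [set: 'I_n] :&: finset.setX K (~: (N :|: A)) = finset.set0.
  apply/finset.setP => -[x y]; rewrite !inE /= andbT.
  by apply/negP => /and3P[xA xK _]; rewrite (disjointFr dK xK) in xA.
rewrite cards0 subn0 -/k.
have := cardsC (N :|: A); have := leq_card_setU N A; rewrite card_ord (eqP NK).
have kn : (k <= n)%N by rewrite -[X in (_ <= X)%N]card_ord max_card.
move: CK => /andP[k1 _]; move: #|~: (N :|: A)| #|N :|: A| #|A| => c u a [ua _] uc.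
(* A sink costs the [n] pairs of its row but may spare the [k] pairs from [K] to it: a net cost of
   at least [n - k], on top of [k * (n - k.-1)]. *)
have ca : (n - k.-1 <= c + a)%N by lia.
rewrite (_ : a * n = (n - k) * a + k * a)%N; last by rewrite -mulnDl subnK// mulnC.
by rewrite addnC -addnA leq_add2l addnC -mulnDr leq_mul2l ca orbT.
Qed.

End Gnp.

(** * Numerical bounds for the cluster terms *)

Section Estimates.
Variable R : realType.
Implicit Types (x z p K C L : R).

(** Division-free form of [C(n, k) <= (e n / k)^k]. It follows from [k^k <= k! e^k], which keeps one
    term of the exponential series. *)
Lemma bin_expR_le n k : 'C(n, k)%:R * k%:R ^+ k <= (expR 1 * n%:R) ^+ k :> R.
Proof.
have kk : k%:R ^+ k <= k`!%:R * expR 1 ^+ k :> R.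
  case: k => [|k]; first by rewrite !expr0 mulr1 fact0.
  rewrite -expRM_natr mul1r mulrC -ler_pdivrMr ?ltr0n ?fact_gt0//.
  by apply: le_trans (expR_ge1Dxn k _) => //; rewrite lerDr.
apply: le_trans (ler_wpM2l (ler0n _ _) kk) _.
rewrite mulrA -natrM exprMn mulrC ler_wpM2l ?exprn_ge0 ?expR_ge0//.
rewrite bin_ffact -natrX ler_nat; elim: k {kk} => // k IH.
by rewrite ffactnSr expnSr leq_mul// leq_subr.
Qed.

(** With [m = k - 1], three uses of [bin_expR_le] leave the factor [k^(2m) / (k^k m^m 4^m)], which
    is at most 1 because [k <= 4m]. *)
Lemma bin3_le n k : (1 < k)%N ->
  'C(n, k)%:R * 'C(n, k.-1)%:R * 'C(k * k.-1, k.-1.*2)%:R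
  <= expR 1 ^+ (4 * k) * n%:R ^+ (k.-1.*2.+1) :> R.
Proof.
case: k => // m; rewrite ltnS => m0 /=; set k := m.+1; set e := expR 1 : R.
have e1 : 1 <= e by rewrite -expR0 ler_expR.
have mR : 0 < m%:R :> R by rewrite ltr0n.
have kR : 0 < k%:R :> R by rewrite ltr0n.
have b1 := bin_expR_le n k; have b2 := bin_expR_le n m.
have b3 : 'C(k * m, m.*2)%:R * 4 ^+ m <= (e * k%:R) ^+ m.*2 :> R.
  have E : m.*2%:R ^+ m.*2 = 4 ^+ m * m%:R ^+ m.*2 :> R.
    by rewrite -mul2n natrM exprMn [2 ^+ (2 * m)]exprM -natrX.
  have F : (e * (k * m)%:R) ^+ m.*2 = (e * k%:R) ^+ m.*2 * m%:R ^+ m.*2.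
    by rewrite natrM mulrA exprMn.
  by have := bin_expR_le (k * m) m.*2; rewrite E -/e F mulrA ler_pM2r// exprn_gt0.
rewrite -(ler_pM2r (_ : 0 < k%:R ^+ k * m%:R ^+ m * 4 ^+ m)); last first.
  by rewrite !mulr_gt0// exprn_gt0.
set X1 := 'C(n, k)%:R in b1 *; set X2 := 'C(n, m)%:R in b2 *.
set X3 := 'C(k * m, m.*2)%:R in b3 *.
have -> : X1 * X2 * X3 * (k%:R ^+ k * m%:R ^+ m * 4 ^+ m) =
  (X1 * k%:R ^+ k) * (X2 * m%:R ^+ m) * (X3 * 4 ^+ m) by ring.
apply: (@le_trans _ _ ((e * n%:R) ^+ k * (e * n%:R) ^+ m * (e * k%:R) ^+ m.*2)).
  by rewrite !ler_pM// !mulr_ge0// ?ler0n// ?exprn_ge0.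
have -> : (e * n%:R) ^+ k * (e * n%:R) ^+ m * (e * k%:R) ^+ m.*2 =
   n%:R ^+ m.*2.+1 * (e ^+ (k + m + m.*2) * k%:R ^+ m.*2).
  rewrite !exprMn !exprD (_ : m.*2.+1 = k + m)%N ?exprD; last by rewrite /k; lia.
  by ring.
rewrite [e ^+ (4 * k) * _]mulrC -[leRHS]mulrA ler_wpM2l ?exprn_ge0//.
have e0 : 0 <= e := expR_ge0 1.
apply: ler_pM; [exact: exprn_ge0|exact: exprn_ge0|by rewrite ler_weXn2l//; lia|].
have -> : m.*2 = (k + m.-1)%N by rewrite /k; lia.
rewrite exprD -mulrA ler_wpM2l ?exprn_ge0//.
apply: (@le_trans _ _ (k%:R ^+ m)); first by rewrite ler_weXn2l ?ler1n//; lia.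
rewrite -exprMn lerXn2r ?nnegrE ?mulr_ge0//.
by rewrite -natrM ler_nat /k; lia.
Qed.

Lemma expr_1D_le x n : 0 <= x -> (1 + x) ^+ n <= expR (n%:R * x).
Proof.
by move=> x0; rewrite expRM_natl lerXn2r ?nnegrE ?expR_ge0 ?expR_ge1Dx ?addr_ge0.
Qed.

Lemma expr_1B_le p n : p <= 1 -> (1 - p) ^+ n <= expR (- (p * n%:R)).
Proof.
move=> p1; rewrite -mulNr expRM_natr lerXn2r ?nnegrE ?expR_ge0 ?subr_ge0//.
exact: expR_ge1Dx.
Qed.

(** Here [L] is the logarithm of [n]. First [n (1 - p)^(n - k) <= expR C * expR (p * k)]; then [expR
    (p * k) <= 1 + p k expR (p * k) <= 1 + k <= 2 k], as [p k <= L / 2 + C / 2 + 1]. *)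
Lemma cluster_outside_le n k p C L : (0 < k)%N -> (k <= n)%N -> (k.*2 <= n.+1)%N ->
  0 <= p <= 1 -> n%:R = expR L -> L - C <= n%:R * p <= L + C ->
  p * expR (L / 2 + C / 2 + 1) <= 1 ->
  (1 + (1 - p) ^+ (n - k)) ^+ n <= expR (2 * expR C * k%:R).
Proof.
move=> k0 kn k2 /andP[p0 p1] nL /andP[np1 np2] ps.
apply: le_trans (expr_1D_le _ _) _; first by rewrite exprn_ge0// subr_ge0.
rewrite ler_expR; have kR : k%:R *+ 2 <= n%:R + 1 :> R.
  by rewrite natr1 -mulrnA muln2 ler_nat.
apply: (@le_trans _ _ (expR C * expR (p * k%:R))).
  rewrite nL; apply: le_trans (ler_wpM2l (expR_ge0 _) (expr_1B_le _ p1)) _.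
  by rewrite natrB// -!expRD ler_expR; lra.
rewrite [2 * _]mulrC -mulrA ler_wpM2l ?expR_ge0//.
have k1 : 1 <= k%:R :> R by rewrite ler1n.
suff : expR (p * k%:R) - 1 <= k%:R by lra.
have pk : expR (p * k%:R) - 1 <= p * k%:R * expR (p * k%:R).
  have := expR_ge1Dx (- (p * k%:R)); rewrite expRN => h.
  have := ler_wpM2r (expR_ge0 (p * k%:R)) h; rewrite mulVf ?gt_eqF ?expR_gt0//; lra.
apply: le_trans pk _; rewrite mulrAC -[leRHS]mul1r ler_wpM2r//.
by apply: le_trans ps; rewrite ler_wpM2l// ler_expR; nra.
Qed.

Lemma cluster_inside_le n k p C L : (1 < k)%N -> (k <= n)%N -> (k.*2 <= n.+1)%N ->
  0 <= p <= 1 -> 0 <= C -> L - C <= n%:R * p ->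
  (1 - p) ^+ (k * (n - k.-1)) <= expR (- (L / 2) * (k%:R + 1) + (C + 1) * k%:R).
Proof.
move=> k1 kn k2 /andP[p0 p1] C0 np; apply: le_trans (expr_1B_le _ p1) _.
rewrite ler_expR natrM natrB; last by lia.
have kR : k%:R *+ 2 <= n%:R + 1 :> R by rewrite natr1 -mulrnA muln2 ler_nat.
have -> : k.-1%:R = k%:R - 1 :> R by rewrite -subn1 natrB//; lia.
have kge : 2 <= k%:R :> R by rewrite ler_nat.
(* The right-hand side is concave in [k], and the left-hand side is its chord between [k = 1] and
   [k = (n + 1) / 2]. *)
have h : n%:R * (k%:R + 1) / 2 - (k%:R - 1) / 2 <= k%:R * (n%:R - (k%:R - 1)) :> R by nra.
have := ler_wpM2l p0 h.
have := ler_wpM2r (_ : 0 <= (k%:R + 1) / 2) np => /(_ (ltac:(lra))).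
nra.
Qed.

(* With n = expR L, the bound is sqrt n * y ^+ k for y of order n ^- (3 / 8). *)
Lemma cluster_term_le n k p C L K : (1 < k)%N -> (k <= n)%N -> (k.*2 <= n.+1)%N ->
  0 <= p <= 1 -> 0 <= C -> 0 <= L -> 1 <= K ->
  n%:R = expR L -> L - C <= n%:R * p <= L + C -> n%:R * p <= K * expR (L / 16) ->
  p * expR (L / 2 + C / 2 + 1) <= 1 ->
  'C(n, k)%:R * cluster_term n p k <= expR (L / 2) *
   (K ^+ 2 * expR (5 + C + 2 * expR C) * expR (- (3 / 8 * L))) ^+ k.
Proof.
move=> k1 kn k2 p01 C0 L0 K1 nL np npK ps; have /andP[p0 p1] := p01.
have /andP[np1 _] := np.
have h1 := bin3_le n k1.
have h2 := cluster_outside_le (ltnW k1) kn k2 p01 nL np ps.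
have h3 := cluster_inside_le k1 kn k2 p01 C0 np1.
(* Raising the exponent to [k.*2] is allowed since the new base is at least 1; it turns this factor
   into a [k]-th power. *)
have h4 : (n%:R * p) ^+ k.-1.*2 <= (K * expR (L / 16)) ^+ k.*2.
  have K0 : 1 <= K * expR (L / 16).
    by rewrite mulr_ege1//; have := expR_ge1Dx (L / 16); lra.
  apply: (@le_trans _ _ ((K * expR (L / 16)) ^+ k.-1.*2)).
    by rewrite lerXn2r ?nnegrE ?(mulr_ge0 _ p0)// (le_trans ler01).
  by rewrite ler_weXn2l// leq_double leq_pred.
rewrite /cluster_term.
set B1 := 'C(n, k)%:R in h1 *; set B2 := 'C(n, k.-1)%:R in h1 *.
set B3 := 'C(_, k.-1.*2)%:R in h1 *; set X := (1 - p) ^+ _ in h3 *.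
set Y := (1 + _) ^+ n in h2 *.
have X0 : 0 <= X by rewrite exprn_ge0// subr_ge0.
have Y0 : 0 <= Y by rewrite exprn_ge0// addr_ge0// exprn_ge0// subr_ge0.
have -> : B1 * (B2 * B3 * p ^+ k.-1.*2 * X * Y) = (B1 * B2 * B3) * p ^+ k.-1.*2 * X * Y by ring.
apply: (@le_trans _ _ (expR 1 ^+ (4 * k) * n%:R ^+ k.-1.*2.+1 * p ^+ k.-1.*2 *
   expR (- (L / 2) * (k%:R + 1) + (C + 1) * k%:R) * expR (2 * expR C * k%:R))).
  apply: ler_pM => //; first by rewrite !mulr_ge0// exprn_ge0.
  apply: ler_pM => //; first by rewrite !mulr_ge0// exprn_ge0.
  by rewrite ler_wpM2r// exprn_ge0.
have -> : expR 1 ^+ (4 * k) * n%:R ^+ k.-1.*2.+1 * p ^+ k.-1.*2 =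
    expR 1 ^+ (4 * k) * n%:R * (n%:R * p) ^+ k.-1.*2 by rewrite exprS exprMn; ring.
apply: (@le_trans _ _ (expR 1 ^+ (4 * k) * n%:R * (K * expR (L / 16)) ^+ k.*2 *
   expR (- (L / 2) * (k%:R + 1) + (C + 1) * k%:R) * expR (2 * expR C * k%:R))).
  rewrite ler_wpM2r ?expR_ge0// ler_wpM2r ?expR_ge0// ler_wpM2l//.
set T := K ^+ 2 ^+ k; rewrite le_eqVlt; apply/orP; left; apply/eqP.
have -> : (K * expR (L / 16)) ^+ k.*2 = T * expR (L / 16 * (2 * k%:R)).
  by rewrite -natrM mul2n expRM_natr exprMn /T -exprM mul2n.
have -> : expR 1 ^+ (4 * k) = expR (4 * k%:R) :> R by rewrite -natrM -expRM_natr mul1r.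
rewrite exprMn [X in _ = _ * (X * _)]exprMn -/T -!expRM_natr nL.
set u := - (L / 2) * _ + _; set v := 2 * _ * _.
transitivity (T * expR (4 * k%:R + L + L / 16 * (2 * k%:R) + u + v)).
  by rewrite !expRD; ring.
(* The exponent of [n] is [1 + k / 8 - (k + 1) / 2 = 1 / 2 - 3 k / 8]. *)
transitivity (T * expR (L / 2 + (5 + C + 2 * expR C) * k%:R + - (3 / 8 * L) * k%:R)).
  by congr (_ * expR _); rewrite /u /v; field.
by rewrite !expRD; ring.
Qed.

Lemma sum_expr_ge2 z N : 0 <= z <= 2^-1 ->
  \sum_(k < N | (1 < k)%N) z ^+ k <= 2 * z ^+ 2.
Proof.
move=> /andP[z0 z1]; suff : (\sum_(k < N | (1 < k)%N) z ^+ k) * (1 - z) <= z ^+ 2.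
  have : 0 <= \sum_(k < N | (1 < k)%N) z ^+ k by apply: sumr_ge0 => k _; exact: exprn_ge0.
  nra.
case: N => [|[|N]]; rewrite ?big_ord0 ?big_mkcond ?big_ord1 ?mul0r ?exprn_ge0//=.
suff -> : (\sum_(k < N.+2) (if (1 < k)%N then z ^+ k else 0)) * (1 - z) = z ^+ 2 - z ^+ N.+2.
  by rewrite gerBl exprn_ge0.
elim: N => [|N IH]; first by rewrite !big_ord_recr big_ord0 /= subrr !addr0 mul0r.
by rewrite big_ord_recr mulrDl IH /= (exprS z N.+2); ring.
Qed.

End Estimates.

Local Open Scope classical_set_scope.
Local Open Scope ring_scope.

(** * Generic realizations *)

(** All that the Fubini argument needs of a polynomial function; the property passes to slices by
    plain substitution. *)
Definition separately_polynomial (R : realType) (m : nat)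
    (f : m.-tuple R -> R) : Prop :=
  forall (x : m.-tuple R) (i : 'I_m), exists q : {poly R},
    forall u, f [tuple if j == i then u else tnth x j | j < m] = q.[u].

Lemma finite_roots (R : idomainType) (q : {poly R}) : q != 0 ->
  finite_set [set u : R | root q u].
Proof.
move=> q0; apply: contrapT => /(infinite_set_fset (size q))[F Fq qF].
have /max_poly_roots : q != 0 by [].
move=> /(_ (finmap.enum_fset F)) Fsz; move: qF; apply/negP; rewrite -ltnNge.
by apply: Fsz (finmap.fset_uniq F); apply/allP => u uF; exact: Fq.
Qed.

(** Induction on [m] by Fubini. As a polynomial in the first coordinate, [f] is nonzero over [t0],
    so it vanishes there for finitely many [u] only; for any other [u] the slice is nonzero at [t0],
    hence has a null zero set. *)
Lemma lebesgue_tuple_zeros (R : realType) (m : nat)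
    (f : m.-tuple (measurableTypeR R) -> measurableTypeR R)
    (x0 : m.-tuple R) :
  measurable_fun setT f -> separately_polynomial f -> f x0 != 0 ->
  lebesgue_tuple R m (f @^-1` [set 0]) = 0%E.
Proof.
elim: m f x0 => [|m IHm] f x0 mf pf fx0.
  rewrite /= diracE memNset//=; rewrite (tuple0 x0) in fx0.
  by move=> f0; rewrite f0 eqxx in fx0.
case/tupleP: x0 fx0 => u0 t0 fx0.
have [q qE] := pf [tuple of u0 :: t0] ord0.
have consE u : [tuple if j == ord0 then u else tnth [tuple of u0 :: t0] j | j < m.+1]
    = [tuple of u :: t0].
  apply/eq_from_tnth => j; rewrite tnth_mktuple.
  by case: (unliftP ord0 j) => [k|] ->; rewrite ?eqxx ?tnth0//= !tnthS.
have q0 : q != 0.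
  by apply: contraNneq fx0 => q0; rewrite -(consE u0) qE q0 horner0.
rewrite /lebesgue_tuple -/lebesgue_tuple /= /lebesgue_step /pushforward /product_measure1.
set Z := _ @^-1` (f @^-1` _).
have mZ : measurable Z.
  rewrite -[X in measurable X]setTI; apply: measurable_tuple_of_pair => //.
  by rewrite -[X in measurable X]setTI; apply: mf.
have secE u : xsection Z u =
    (fun t : m.-tuple (measurableTypeR R) => f [tuple of u :: t]) @^-1` [set 0].
  by apply/seteqP; split => t /=; rewrite /xsection/= in_setE.
have roots_null : lebesgue_measure [set u : R | root q u] = 0%E.
  apply/countable_lebesgue_measure0/finite_set_countable.
  exact: finite_roots.
rewrite (ge0_ae_eq_integral (g := cst 0%E))//= ?integral0//.
- exact: measurable_fun_xsection.
- exists [set u : R | root q u]; split => //.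
    exact/countable_measurable/finite_set_countable/finite_roots.
  move=> u /=; apply: contra_notT => qu _.
  rewrite secE; apply: (IHm _ t0).
  + have := measurableT_comp mf (measurable_tuple_of_pair (R := R) (m := m)).
    by move=> /(measurable_fun_pair2 u).
  + move=> t i; have [r rE] := pf [tuple of u :: t] (lift ord0 i).
    exists r => v; rewrite -rE; congr f; apply/eq_from_tnth => j.
    rewrite tnth_mktuple; case: (unliftP ord0 j) => [k|] ->.
      by rewrite !tnthS tnth_mktuple (inj_eq lift_inj).
    by rewrite (negbTE (neq_lift _ _)) !tnth0.
  + by rewrite -consE qE.
Qed.

Lemma measurable_meval (R : realType) (m : nat) (P : mpoly.mpoly m R) :
  measurable_fun setT (fun x : m.-tuple (measurableTypeR R) =>
    mpoly.meval (tnth x) P : measurableTypeR R).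
Proof.
under eq_fun do rewrite mpoly.mevalE.
apply: measurable_sum => k; apply: measurable_funM => //.
apply: measurable_prod => i _; apply: measurable_funX.
exact: measurable_tnth.
Qed.

Lemma separately_polynomial_meval (R : realType) (m : nat)
    (P : mpoly.mpoly m R) :
  separately_polynomial (fun x : m.-tuple R => mpoly.meval (tnth x) P).
Proof.
move=> x i; exists (\sum_(k <- mpoly.msupp P) (mpoly.mcoeff k P)%:P *
  \prod_j (if j == i then 'X else (tnth x j)%:P) ^+ mpoly.fun_of_multinom k j).
move=> u; rewrite mpoly.mevalE horner_sum; apply: eq_bigr => k _.
rewrite hornerM hornerC horner_prod; congr (_ * _); apply: eq_bigr => j _.
by rewrite tnth_mktuple horner_exp; case: eqP => _; rewrite ?hornerX ?hornerC.
Qed.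

Lemma ae_meval_neq0 (R : realType) (m : nat) (P : mpoly.mpoly m R)
    (x0 : m.-tuple R) :
  mpoly.meval (tnth x0) P != 0 ->
  {ae lebesgue_tuple R m, forall x, mpoly.meval (tnth x) P != 0}.
Proof.
move=> Px0; pose f (x : m.-tuple (measurableTypeR R)) : measurableTypeR R :=
  mpoly.meval (tnth x) P.
exists (f @^-1` [set 0]); split.
- rewrite -[X in measurable X]setTI; apply: measurable_meval => //.
- apply: (lebesgue_tuple_zeros (x0 := x0)) => //.
    exact: measurable_meval.
  exact: separately_polynomial_meval.
- by move=> x /= /negP; rewrite negbK => /eqP.
Qed.

(** The whole space has positive measure, so two generic properties that exclude each other cannot
    both hold. *)
Lemma lebesgue_tuple_ae_False (R : realType) (m : nat) :
  {ae lebesgue_tuple R m, forall x, False} -> False.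
Proof.
move=> [A [mA A0 TA]].
have := @lebesgue_tuple_box R m (fun=> setT).
rewrite (_ : [set _ | _] = A); last first.
  by apply/seteqP; split => // x _; apply: TA.
rewrite A0; suff : (0 < \prod_(i < m) lebesgue_measure [set: measurableTypeR R])%E.
  by move=> /[swap] /(_ (fun=> measurableT)) <-; rewrite ltxx.
apply: (big_ind (fun x : \bar R => (0 < x)%E)) => //; first exact: mule_gt0.
move=> _ _; apply: (@lt_le_trans _ _ (lebesgue_measure `[0%R : R, 1%R])).
  by rewrite lebesgue_measure_itv /= lte_fin ltr01 /= oppr0 adde0 lte_fin.
by apply: le_measure => //; rewrite inE.
Qed.

#[local] Instance ae_lebesgue_tuple_filter (R : realType) (m : nat) :
  Filter (nbhs (almost_everywhere (lebesgue_tuple R m))).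
Proof.
exact: (@ae_filter_ringOfSetsType _ (m.-tuple (measurableTypeR R))).
Qed.

(** Turns separability into the nonvanishing of a polynomial in the coefficients, which can be
    tested at one point. *)
Lemma separable_resultant (F : fieldType) (p : {poly F}) :
  p != 0 -> separable_poly p = (resultant p p^`() != 0).
Proof.
move=> p0; rewrite resultant_eq0 unlock coprimep_def -leqNgt eqn_leq.
by rewrite andb_idr// => _; rewrite size_poly_gt0 gcdp_eq0 negb_and p0.
Qed.

(** The sizes of [p] and [q] fix the shape of the Sylvester matrix; the hypotheses on the leading
    coefficients preserve them under [f]. *)
Lemma map_resultant_ring (aR rR : comNzRingType) (f : {rmorphism aR -> rR})
    (p q : {poly aR}) :
  f (lead_coef p) != 0 -> f (lead_coef q) != 0 ->
  f (resultant p q) = resultant (map_poly f p) (map_poly f q).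
Proof.
move=> fp fq; rewrite /resultant -det_map_mx /Sylvester_mx.
rewrite !(size_map_poly_id0 fp) !(size_map_poly_id0 fq) map_col_mx.
by congr (\det (col_mx _ _)); apply: map_lin1_mx => v;
  rewrite map_poly_rV rmorphM /= map_rVpoly.
Qed.

Lemma lead_coef_deriv_monic (F : idomainType) (p : {poly F}) n :
  [pchar F] =i pred0 -> p \is monic -> size p = n.+2 -> lead_coef p^`() = n.+1%:R.
Proof.
move=> /pcharf0P F0 /monicP lp sp; have sd : size p^`() = n.+1.
  apply/anti_leq; rewrite -ltnS -sp lt_size_deriv ?monic_neq0//=; last by apply/monicP.
  rewrite ltnNge; apply/negP => /leq_sizeP/(_ n (leqnn n)).
  rewrite coef_deriv; move: lp; rewrite lead_coefE sp /= => -> /eqP.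
  by rewrite F0.
by rewrite lead_coefE sd coef_deriv; move: lp; rewrite lead_coefE sp /= => ->.
Qed.

Section Weights.
Variables (R : rcfType) (n : nat) (s : {perm 'I_n.+1}).

(** A numbering of the orbits, shifted by 1 so that no weight is 0. Positivity keeps the powers [r i
    ^+ #[s]] of different orbits distinct. *)
Definition orbit_weight (i : 'I_n.+1) : R := (enum_rank (porbit s i)).+1%:R.

Lemma separable_orbit_weight_mx :
  separable_poly ('X * char_poly (weighted_perm_mx s orbit_weight)).
Proof.
rewrite -(separable_map (real_complex R)) rmorphM /= map_polyX map_char_poly.
have -> : map_mx (real_complex R) (weighted_perm_mx s orbit_weight) =
    weighted_perm_mx s (fun i => real_complex R (orbit_weight i)).
  by apply/matrixP => i j; rewrite !mxE rmorphMn.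
apply: separable_weighted_perm.
- move=> i; congr (real_complex R _.+1%:R); congr (nat_of_ord (enum_rank _)).
  by apply/eqP; rewrite eq_porbit_mem -{1}(expg1 s) mem_porbit.
- move=> i j; rewrite -!(rmorphXn (real_complex R)) => /complexI E.
  have /eqP : orbit_weight i ^+ #[s]%g = orbit_weight j ^+ #[s]%g :> R by exact: E.
  rewrite (eqrXn2 (order_gt0 _)) ?ler0n// eqr_nat eqSS => /eqP/ord_inj/enum_rank_inj ->.
  exact: porbit_id.
- by move=> i; rewrite fmorph_eq0 pnatr_eq0.
- by rewrite pnatr_eq0 -lt0n order_gt0.
Qed.
End Weights.

Section Completed.
Variables (n : nat) (S T : {set 'I_n}) (s : {perm 'I_n}).

(* Rows in S carry the weights r along s, the other rows lose their columns in T;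
   on the realization with weights r along s, this gives weighted_perm_mx s r. *)
Definition completed_mx (F : pzRingType) (r : 'I_n -> F) (M : 'M[F]_n) : 'M[F]_n :=
  \matrix_(i, j) if i \in S then r i *+ (s i == j)
                 else if j \in T then 0 else M i j.

Lemma map_completed_mx (F K : pzRingType) (f : {rmorphism F -> K}) r r' M :
  f \o r =1 r' -> map_mx f (completed_mx r M) = completed_mx r' (map_mx f M).
Proof.
move=> fr; apply/matrixP => i j; rewrite !mxE -fr.
by case: ifP => _; [rewrite rmorphMn|case: ifP => _; rewrite ?rmorph0].
Qed.
End Completed.

Section Generic.
Variables (R : realType) (n : nat) (E : digraph n).

(** The realization by indeterminates. Off [E] the index equals [#|E|], so the sum is empty and the
    entry is 0. *)
Definition generic_mx : 'M[mpoly.mpoly #|E| R]_n :=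
  \matrix_(i, j) \sum_(k < #|E| | val k == index (i, j) (enum E))
     mpoly.mpolyX R (mpoly.mnm1 k).

Lemma meval_generic_mx (x : #|E|.-tuple R) :
  map_mx (mpoly.meval (tnth x)) generic_mx = realization x.
Proof.
apply/matrixP => i j; rewrite !mxE rmorph_sum /=.
under eq_bigr do rewrite mpoly.mevalXU.
case: ifP => [ij|/negP ij]; last first.
  rewrite big1// => k /eqP kE; case: ij; rewrite -mem_enum -index_mem -kE.
  by rewrite -cardE.
have ltE : (index (i, j) (enum E) < #|E|)%N by rewrite cardE index_mem mem_enum.
rewrite (big_pred1 (Ordinal ltE)) => [|k /=]; last by rewrite -val_eqE.
by rewrite (tnth_nth 0).
Qed.

Section GenericCompleted.
Variables (S T : {set 'I_n}) (s : {perm 'I_n}).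
Hypothesis sST : forall i, (s i \in T) = (i \in S).
Hypothesis sE : forall i, i \notin S -> (i, s i) \in E.

Lemma completed_witness (r : 'I_n -> R) :
  exists x : #|E|.-tuple R,
    completed_mx S T s r (realization x) = weighted_perm_mx s r.
Proof.
exists [tuple of [seq r e.1 *+ (s e.1 == e.2) | e <- enum_tuple E]].
apply/matrixP => i j; rewrite !mxE; case: ifPn => // iS; case: ifPn => jT.
  (* Outside [S] the permutation avoids [T], so clearing the columns of [T] loses no weight. *)
  by case: eqP jT => // <-; rewrite sST (negbTE iS).
case: ifPn => ij; first by rewrite (nth_map (i, j)) ?nth_index ?index_mem ?mem_enum.
by case: eqP ij => // <-; rewrite sE.
Qed.

(** The determinant is a polynomial in the edge weights, equal to the signature of [s] at the
    witness. *)
Lemma ae_completed_unitmx : {ae lebesgue_tuple R #|E|, forall x,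
  completed_mx S T s (fun=> 1) (realization x) \in unitmx}.
Proof.
pose P := \det (completed_mx S T s (fun=> 1) generic_mx).
have PE x : mpoly.meval (tnth x) P = \det (completed_mx S T s (fun=> 1) (realization x)).
  rewrite -det_map_mx (@map_completed_mx _ _ _ _ _ _ _ _ (fun=> 1)) ?meval_generic_mx//.
  by move=> i /=; rewrite rmorph1.
have [x0 x0E] := completed_witness (fun=> 1).
have Px0 : mpoly.meval (tnth x0) P != 0.
  rewrite PE x0E (_ : weighted_perm_mx _ _ = perm_mx s).
    by rewrite det_perm signr_eq0.
  by apply/matrixP => i j; rewrite !mxE.
apply: filterS (ae_meval_neq0 Px0) => x.
by rewrite PE unitmxE unitfE.
Qed.

End GenericCompleted.
End Generic.

(** The resultant with the derivative is a polynomial in the edge weights. At the witness the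
    completed matrix is the permutation matrix with orbit weights, for which it is nonzero. *)
Lemma ae_completed_separable (R : realType) n (E : digraph n.+1)
    (S T : {set 'I_n.+1}) (s : {perm 'I_n.+1}) :
  (forall i, (s i \in T) = (i \in S)) ->
  (forall i, i \notin S -> (i, s i) \in E) ->
  {ae lebesgue_tuple R #|E|, forall x, separable_poly
    ('X * char_poly (completed_mx S T s (orbit_weight R s) (realization x)))}.
Proof.
move=> sST sE; set r := orbit_weight R s.
pose rC i := mpoly.mpolyC #|E| (r i).
pose p := 'X * char_poly (completed_mx S T s rC (generic_mx R E)).
pose q (x : #|E|.-tuple R) := 'X * char_poly (completed_mx S T s r (realization x)).
have mon (F : comNzRingType) (A : 'M[F]_n.+1) : 'X * char_poly A \is monic.
  by rewrite rpredM ?monicX ?char_poly_monic.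
have sz (F : idomainType) (A : 'M[F]_n.+1) : size ('X * char_poly A) = n.+3.
  by rewrite mulrC size_mulX ?monic_neq0 ?char_poly_monic ?size_char_poly.
have pq x : map_poly (mpoly.meval (tnth x)) p = q x.
  rewrite /p rmorphM /= map_polyX map_char_poly (@map_completed_mx _ _ _ _ _ _ _ _ r).
    by rewrite meval_generic_mx.
  by move=> i /=; rewrite mpoly.mevalC.
have char0 : [pchar mpoly.mpoly #|E| R] =i pred0.
  move=> k; rewrite inE; apply/negP => /andP[pk /eqP k0].
  have := congr1 (mpoly.meval (fun=> 0)) k0; rewrite rmorph_nat rmorph0 => /eqP.
  by rewrite pnatr_eq0 => /eqP k00; rewrite k00 in pk.
have PE x : mpoly.meval (tnth x) (resultant p p^`()) = resultant (q x) (q x)^`().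
  rewrite map_resultant_ring ?pq.
  - by rewrite -pq deriv_map.
  - by rewrite (monicP (mon _ _)) rmorph1 oner_eq0.
  - by rewrite (lead_coef_deriv_monic char0 (mon _ _) (sz _ _)) rmorph_nat pnatr_eq0.
have [x0 x0E] := completed_witness sST sE r.
have Px0 : mpoly.meval (tnth x0) (resultant p p^`()) != 0.
  rewrite PE -separable_resultant; last by apply: monic_neq0 (mon _ _).
  by rewrite /q x0E; exact: separable_orbit_weight_mx.
apply: filterS (ae_meval_neq0 Px0) => x.
by rewrite PE -separable_resultant //; apply: monic_neq0 (mon _ _).
Qed.

(** * Structural diagonalizability in terms of sinks and sources *)

Lemma realization_notin (R : realType) n (E : digraph n) (x : #|E|.-tuple R) i j :
  (i, j) \notin E -> realization x i j = 0.
Proof. by move=> ij; rewrite mxE (negbTE ij). Qed.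

Lemma realization_sink (R : realType) n (E : digraph n) (x : #|E|.-tuple R) i j :
  i \in sinks E -> realization x i j = 0.
Proof. by rewrite inE => /forallP/(_ j); exact: realization_notin. Qed.

Lemma realization_source (R : realType) n (E : digraph n) (x : #|E|.-tuple R) i j :
  j \in sources E -> realization x i j = 0.
Proof. by rewrite inE => /forallP/(_ i); exact: realization_notin. Qed.

Definition mask_mx (F : pzSemiRingType) n (S : {set 'I_n}) : 'M[F]_n :=
  diag_mx (\row_i (i \in S)%:R).

Lemma mul_mask_mx (F : pzSemiRingType) n (S : {set 'I_n}) (A : 'M[F]_n) i j :
  (mask_mx F S *m A) i j = if i \in S then A i j else 0.
Proof. by rewrite mul_diag_mx !mxE; case: ifP; rewrite ?mul1r ?mul0r. Qed.

Lemma mul_mx_mask (F : pzSemiRingType) n (S : {set 'I_n}) (A : 'M[F]_n) i j :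
  (A *m mask_mx F S) i j = if j \in S then A i j else 0.
Proof. by rewrite mul_mx_diag !mxE; case: ifP; rewrite ?mulr1 ?mulr0. Qed.

Lemma mxrank_mask (F : fieldType) n (S : {set 'I_n}) : (\rank (mask_mx F S) <= #|S|)%N.
Proof.
have -> : mask_mx F S = \sum_(i in S) delta_mx i i.
  apply/matrixP => i j; rewrite !mxE summxE.
  under eq_bigr do rewrite mxE.
  have [iS|iS] := boolP (i \in S); last first.
    rewrite mul0rn big1// => k kS; case: eqP => // ik; by rewrite ik kS in iS.
  rewrite (bigD1 i)//= big1 ?addr0 ?eqxx 1?eq_sym; first by rewrite eq_sym.
  by move=> k /andP[_ /negbTE ki]; rewrite eq_sym ki.
rewrite -sum1_card; elim/big_ind2: _ => [|A1 m1 A2 m2 h1 h2|i _].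
- by rewrite mxrank0.
- by rewrite (leq_trans (mxrank_add _ _))// leq_add.
- by rewrite mxrank_delta.
Qed.

Lemma structurally_diagonalizable_annihilated (R : realType) n (E : digraph n.+1)
    (S T : {set 'I_n.+1}) (s : {perm 'I_n.+1}) :
  (forall i, (s i \in T) = (i \in S)) ->
  (forall i, i \notin S -> (i, s i) \in E) ->
  (forall x : #|E|.-tuple R, let M := realization x in
    horner_mx M ('X * char_poly (completed_mx S T s (orbit_weight R s) M)) = 0) ->
  structurally_diagonalizable R E.
Proof.
move=> sST sE ann; apply: filterS (ae_completed_separable R sST sE) => x sep.
have /(congr1 (map_mx (real_complex R))) := ann x.
rewrite map_horner_mx map_mx0 => /(diagonalizable_annihilated _); apply.
by rewrite separable_map.
Qed.

(** Let [N] be the completed matrix, of full size, and [J] the projection away from the sinks. Then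
    [J M = M] since sink rows vanish, and [M J = J N] since [J] removes the rows of [N] with
    prescribed weights. *)
Lemma structurally_diagonalizable_sinks (R : realType) n (E : digraph n.+1)
    (s : {perm 'I_n.+1}) :
  (forall i, (s i \in sinks E) = (i \in sinks E)) ->
  (forall i, i \notin sinks E -> (i, s i) \in E) ->
  structurally_diagonalizable R E.
Proof.
move=> sA sE; apply: (structurally_diagonalizable_annihilated sA sE) => x M.
apply: (@horner_mx_char_poly_intertwine _ _ _ _ (mask_mx R (~: sinks E))).
  apply/matrixP => i j; rewrite mul_mask_mx finset.in_setC; case: ifPn => //.
  by rewrite negbK => iA; rewrite realization_sink.
apply/matrixP => i j; rewrite mul_mask_mx mul_mx_mask !finset.in_setC [in RHS]mxE.
case: (boolP (j \in sinks E)) => jA /=; last first.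
  by case: (boolP (i \in sinks E)) => iA //=; rewrite realization_sink.
by case: (boolP (i \in sinks E)).
Qed.

Lemma structurally_diagonalizable_sources (R : realType) n (E : digraph n.+1)
    (s : {perm 'I_n.+1}) :
  (forall i, (s i \in sources E) = (i \in sources E)) ->
  (forall i, i \notin sources E -> (i, s i) \in E) ->
  structurally_diagonalizable R E.
Proof.
move=> sB sE; apply: (structurally_diagonalizable_annihilated sB sE) => x M.
apply: (@horner_mx_char_poly_intertwine_dual _ _ _ _ (mask_mx R (~: sources E))).
  apply/matrixP => i j; rewrite mul_mx_mask finset.in_setC; case: ifPn => //.
  by rewrite negbK => jB; rewrite realization_source.
apply/matrixP => i j; rewrite mul_mask_mx mul_mx_mask !finset.in_setC [in RHS]mxE.
case: (boolP (j \in sources E)) => jB /=.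
  by case: (boolP (i \in sources E)) => iB //=; rewrite realization_source.
case: (boolP (i \in sources E)) => iB //=.
(* In a row of [sources E] the prescribed weight sits in a column of [sources E], which the
   projection clears. *)
by case: eqP => // sij; rewrite -sij sB iB in jB.
Qed.

(** The completed matrix is generically invertible and, off the rows of [S], is a piece of [M]; so
    [M] has rank at least [n - #|S|]. Every path of length 2 through a sink or a source has weight
    0, so the square has rank at most [n - #|Z|]. *)
Lemma not_structurally_diagonalizable (R : realType) n (E : digraph n)
    (S T : {set 'I_n}) (s : {perm 'I_n}) :
  (forall i, (s i \in T) = (i \in S)) ->
  (forall i, i \notin S -> (i, s i) \in E) ->
  (#|S| < #|sinks E :|: sources E|)%N ->
  ~ structurally_diagonalizable R E.
Proof.
move=> sST sE Slt sd; apply: (@lebesgue_tuple_ae_False R #|E|).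
apply: filterS2 sd (ae_completed_unitmx R sST sE) => x.
set M := realization x; set Z := sinks E :|: sources E in Slt *.
move=> /mxrank_diagonalizable_sqr; rewrite -map_mxM !mxrank_map => M2.
rewrite -row_free_unit => /eqP Nn.
have : (n <= #|S| + \rank M)%N.
  rewrite -[X in (X <= _)%N]Nn.
  have -> : completed_mx S T s (fun=> 1) M = mask_mx R S *m weighted_perm_mx s (fun=> 1)
      + mask_mx R (~: S) *m M *m mask_mx R (~: T).
    apply/matrixP => i j; rewrite mxE [RHS]mxE mul_mx_mask !mul_mask_mx !inE !mxE.
    by case: (i \in S); case: (j \in T); rewrite ?addr0 ?add0r.
  apply: leq_trans (mxrank_add _ _) (leq_add _ _).
    exact: leq_trans (mxrankM_maxl _ _) (mxrank_mask _ _).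
  exact: leq_trans (mxrankM_maxl _ _) (mxrankM_maxr _ _).
have : (\rank (M *m M) <= n - #|Z|)%N.
  have -> : M *m M = M *m mask_mx R (~: Z) *m M.
    apply/matrixP => i j; rewrite !mxE; apply: eq_bigr => k _.
    rewrite mul_mx_mask finset.in_setC; case: ifPn => //.
    rewrite negbK finset.in_setU => /orP[kA|kB].
      by rewrite (realization_sink _ _ kA) !mulr0.
    by rewrite (realization_source _ _ kB) mul0r.
  have <- : #|~: Z| = (n - #|Z|)%N by rewrite cardsCs finset.setCK card_ord.
  exact: leq_trans (mxrankM_maxl _ _) (leq_trans (mxrankM_maxr _ _) (mxrank_mask _ _)).
have Zn : (#|Z| <= n)%N by rewrite -[X in (_ <= X)%N]card_ord max_card.
move=> MM nS; have : (n < n)%N; last by rewrite ltnn.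
rewrite -[X in (_ < X)%N](subnKC Zn) (leq_ltn_trans nS)//.
by rewrite -addSn leq_add// (leq_trans M2).
Qed.

Lemma structurally_diagonalizableP (R : realType) n (E : digraph n.+1) :
  ~ bad E -> ~ bad (converse E) -> sinks E :&: sources E = finset.set0 ->
  structurally_diagonalizable R E <-> sinks E = finset.set0 \/ sources E = finset.set0.
Proof.
move=> nb nbc dis; set Z := sinks E :|: sources E.
have AZ : sinks E \subset Z by exact: finset.subsetUl.
have BZ : sources E \subset Z by exact: finset.subsetUr.
split=> [sd|[A0|B0]].
- have [|[a aA]] := set_0Vmem (sinks E); first by left.
  have [|[b bB]] := set_0Vmem (sources E); first by right.
  have aB : a \notin sources E.
    by apply/negP => aB; have := finset.in_set0 a; rewrite -dis finset.in_setI aA aB.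
  have bA : b \notin sinks E.
    by apply/negP => bA; have := finset.in_set0 b; rewrite -dis finset.in_setI bA bB.
  have aZ := fintype.subsetP AZ _ aA; have bZ := fintype.subsetP BZ _ bB.
  have cZb := cardsD1 b Z; have cZa := cardsD1 a Z; rewrite aZ bZ !add1n in cZa cZb.
  (* Disjointness keeps the sinks inside [Z :\ b] and the sources inside [Z :\ a], two sets of size
     [#|Z| - 1]. *)
  have [||||| s sST sE] := @perm_of_not_bad _ E (Z :\ b) (Z :\ a) nb nbc.
  + by rewrite finset.subsetD1 AZ.
  + by rewrite subD1set.
  + by rewrite finset.subsetD1 BZ.
  + by rewrite subD1set.
  + by apply/eqP; rewrite -eqSS -cZa -cZb.
  by exfalso; apply: (not_structurally_diagonalizable sST sE _ sd); rewrite -/Z cZb.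
- have [||||| s sST sE] := @perm_of_not_bad _ E (sources E) (sources E) nb nbc => //.
    by rewrite A0 finset.sub0set.
  exact: (structurally_diagonalizable_sources R sST sE).
- have [||||| s sST sE] := @perm_of_not_bad _ E (sinks E) (sinks E) nb nbc => //.
    by rewrite B0 finset.sub0set.
  exact: (structurally_diagonalizable_sinks R sST sE).
Qed.

(** * Limits *)

Section Limits.
Variable R : realType.
Implicit Types (x l : R) (u : nat -> R).

(** The inequality [ln (1 + y) <= y] at [y = - x / (1 + x)] gives [ln (1 + x) >= x - x^2 / (1 + x)],
    and [1 + x >= 1 / 2]. *)
Lemma ln1D_ge x : - (2^-1) <= x -> x - 2 * x ^+ 2 <= ln (1 + x).
Proof.
move=> x2; have x1 : 0 < 1 + x by lra.
have -> : ln (1 + x) = - ln (1 + - (x / (1 + x))).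
  rewrite -lnV ?posrE; last first.
    by rewrite (_ : 1 + - _ = (1 + x)^-1) ?invr_gt0//; field; lra.
  by congr ln; field; lra.
have y1 : - 1 < - (x / (1 + x)) by rewrite ltrN2 ltr_pdivrMr//; lra.
rewrite lerNr; apply: le_trans (le_ln1Dx y1) _.
rewrite lerN2 ler_pdivlMr//; nra.
Qed.

Lemma cvg_invn : (fun n : nat => n%:R^-1 : R) @ \oo --> (0 : R).
Proof. by rewrite -(cvg_shiftS _ _); exact: cvg_harmonic. Qed.

Lemma cvgn_near_eq u (v : nat -> R) l :
  (\forall n \near \oo, u n = v n) -> u @ \oo --> l -> v @ \oo --> l.
Proof. by move=> uv ul; apply: cvg_trans ul; exact: near_eq_cvg. Qed.

Lemma cvg0_of_muln u l : (fun n => n%:R * u n) @ \oo --> l -> u @ \oo --> (0 : R).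
Proof.
move=> ul; have h : (fun n => n%:R * u n * n%:R^-1) @ \oo --> (0 : R).
  by rewrite -(mulr0 l); apply: cvgM => //; exact: cvg_invn.
apply: cvgn_near_eq h; near=> n; rewrite mulrAC mulfV ?mul1r// pnatr_eq0 -lt0n.
by near: n; exact: nbhs_infty_gt.
Unshelve. all: by end_near. Qed.

(** The logarithm [n ln (1 + u n)] lies between [n u n - 2 (n u n) u n] and [n u n]. *)
Lemma cvg_exp1D u l : (fun n => n%:R * u n) @ \oo --> l ->
  (fun n => (1 + u n) ^+ n) @ \oo --> expR l.
Proof.
move=> ul; have u0 := cvg0_of_muln ul.
have u_small : \forall n \near \oo, `|u n| <= 2^-1.
  by apply: (@cvgr0_norm_le R R^o _ _ _ u u0); rewrite invr_gt0.
have lnl : (fun n => n%:R * ln (1 + u n)) @ \oo --> l.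
  apply: (@squeeze_cvgr _ _ _ _ (fun n => n%:R * u n - 2 * (n%:R * u n) * u n)
    (fun n => n%:R * u n)) => //; last first.
    rewrite -[l]subr0 -[X in _ - X](mulr0 (2 * l)).
    by apply: cvgB => //; apply: cvgM => //; apply: cvgM => //; exact: cvg_cst.
  near=> n; have un : `|u n| <= 2^-1.
    by near: n; exact: u_small.
  move: un; rewrite ler_norml => /andP[un1 un2]; apply/andP; split.
    have -> : n%:R * u n - 2 * (n%:R * u n) * u n = n%:R * (u n - 2 * u n ^+ 2) by ring.
    by rewrite ler_wpM2l// ln1D_ge.
  by rewrite ler_wpM2l// le_ln1Dx//; lra.
have h : (fun n => expR (n%:R * ln (1 + u n))) @ \oo --> expR l.
  by apply: continuous_cvg lnl; exact: continuous_expR.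
apply: cvgn_near_eq h; near=> n.
have un : `|u n| <= 2^-1 by near: n; exact: u_small.
rewrite expRM_natl lnK// posrE.
by move: un; rewrite ler_norml => /andP[]; lra.
Unshelve. all: by end_near. Qed.

Lemma expR_ge1Dxx2 x : 0 <= x -> 1 + x + x ^+ 2 / 2 <= expR x.
Proof.
move=> x0; have nd : nondecreasing_seq (series (exp_coeff x)).
  by apply: nondecreasing_series => n _ _; exact: exp_coeff_ge0.
have := nondecreasing_cvgn_le nd (is_cvg_series_exp_coeff x) 3.
rewrite /series /= !big_nat_recr//= big_nil /exp_coeff /= add0r.
by rewrite !factS fact0 !muln1; apply: le_trans; rewrite expr0 expr1 !divr1.
Qed.

End Limits.

Section LogLimits.
Variable R : realType.
Local Notation L n := (ln (n%:R : R)).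

Lemma near_ln_ge (A : R) : \forall n \near \oo, A <= L n.
Proof.
near=> n; rewrite -[A]expRK ler_ln ?posrE ?expR_gt0//.
  by near: n; exact: nbhs_infty_ger.
by rewrite ltr0n; near: n; exact: nbhs_infty_gt.
Unshelve. all: by end_near. Qed.

Lemma cvg_expRN_ln (a : R) : 0 < a -> (fun n => expR (- (a * L n))) @ \oo --> (0 : R).
Proof.
move=> a0; apply/(@cvgr0Pnorm_le R R^o) => e e0; near=> n.
rewrite ger0_norm ?expR_ge0// -[e]lnK ?posrE// ler_expR lerNl -ler_pdivrMl//.
by near: n; exact: near_ln_ge.
Unshelve. all: by end_near. Qed.

Lemma cvgn_dist (u v : nat -> R) (l : R) : (fun n => `|u n - v n|) @ \oo --> (0 : R) ->
  v @ \oo --> l -> u @ \oo --> l.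
Proof.
move=> uv vl; have h : (fun n => u n - v n + v n) @ \oo --> l.
  by rewrite -[l]add0r; apply: cvgD => //; exact: (@norm_cvg0P R R^o _ _ _ _).1.
by rewrite (_ : u = (fun n => u n - v n + v n))//; apply/funext => n; rewrite subrK.
Qed.

End LogLimits.

(** * Limits of the probabilities for [p n = (ln n + c + eps n) / n] *)

Section Asymptotics.
Variables (R : realType) (c : R) (p eps : nat -> R).
Hypothesis heps : eps @ \oo --> 0.
Hypothesis hp : forall n : nat, (0 < n)%N -> p n = (ln n%:R + c + eps n) / n%:R.
Local Notation L n := (ln (n%:R : R)).

(** Bounds [c + eps n] in absolute value once [eps n] is at most 1 in absolute value. *)
Let C : R := `|c| + 1.
(** Chosen for [L n + C <= K * expR (L n / 16)], an instance of [x <= 16 * expR (x / 16)]. *)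
Let K : R := 16 * expR (C / 16).

Let C0 : 0 <= C. Proof. by rewrite addr_ge0. Qed.
Let K1 : 1 <= K.
Proof. by rewrite /K; have := expR_ge1Dx (C / 16); have := C0; lra. Qed.

(** Besides [n p = ln n + O(1)], this records the cruder [n p = O(n^(1/16))], which reduces error
    terms to comparing powers of [n]. *)
Lemma near_edge_prob : \forall n \near \oo,
  [/\ (0 < n)%N /\ 0 <= L n, n%:R = expR (L n),
      L n - C <= n%:R * p n <= L n + C, 0 <= p n <= 1 &
      n%:R * p n <= K * expR (L n / 16) /\ p n <= K * expR (- (15 / 16 * L n))].
Proof.
near=> n; have n0 : (0 < n)%N by near: n; exact: nbhs_infty_gt.
have nR : 0 < n%:R :> R by rewrite ltr0n.
have nL : n%:R = expR (L n) :> R by rewrite lnK.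
have npE : n%:R * p n = L n + c + eps n by rewrite hp// mulrC divfK// gt_eqF.
have e1 : `|eps n| <= 1.
  by near: n; apply: (@cvgr0_norm_le R R^o _ _ _ eps heps).
have LC : C <= L n by near: n; exact: near_ln_ge.
have np1 : L n - C <= n%:R * p n <= L n + C.
  rewrite npE /C; move: e1; rewrite ler_norml => /andP[? ?].
  by have := ler_norm c; have := ler_norm (- c); rewrite normrN => ? ?; lra.
have npK : n%:R * p n <= K * expR (L n / 16).
  case/andP: np1 => _ np1; apply: le_trans np1 _.
  have -> : K * expR (L n / 16) = 16 * expR (C / 16 + L n / 16) by rewrite expRD mulrA.
  by have := expR_ge1Dx (C / 16 + L n / 16); lra.
have pK : p n <= K * expR (- (15 / 16 * L n)).
  rewrite -(ler_pM2l nR) (le_trans npK)//.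
  have -> : n%:R * (K * expR (- (15 / 16 * L n))) = K * expR (L n - 15 / 16 * L n).
    by rewrite expRD -nL mulrCA.
  by rewrite ler_wpM2l ?(le_trans ler01 K1)// ler_expR; lra.
split=> //; first by split=> //; exact: le_trans LC.
apply/andP; split.
  by rewrite -(pmulr_rge0 _ nR); case/andP: np1 => + _; apply: le_trans; rewrite subr_ge0.
apply: le_trans pK _; near: n.
have h : (fun n => K * expR (- (15 / 16 * L n))) @ \oo --> (0 : R).
  rewrite -(mulr0 K); apply: cvgM; first exact: cvg_cst.
  by apply: cvg_expRN_ln; lra.
apply: filterS (@cvgr0_norm_le R R^o _ _ _ _ h 1 ltr01) => m.
by apply: le_trans; exact: ler_norm.
Unshelve. all: by end_near. Qed.

Local Notation q n := (1 - p n).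

Lemma cvg_sqr_edge_prob : (fun n => n%:R * p n ^+ 2) @ \oo --> (0 : R).
Proof.
(* The exponent is [15 / 16 - 1 / 16 = 7 / 8]. *)
apply: (@squeeze_cvgr _ _ _ _ (fun=> 0) (fun n => K ^+ 2 * expR (- (7 / 8 * L n)))).
- apply: filterS near_edge_prob => n [_ _ _ /andP[p0 _] [h1 h2]].
  apply/andP; split; first by rewrite mulr_ge0// exprn_ge0.
  rewrite expr2 mulrA; apply: le_trans (ler_pM _ _ h1 h2) _ => //; first exact: mulr_ge0.
  rewrite mulrACA -expr2 -expRD ler_wpM2l ?exprn_ge0 ?(le_trans ler01 K1)//.
  by rewrite ler_expR; lra.
- exact: cvg_cst.
- rewrite -(mulr0 (K ^+ 2)); apply: cvgM; first exact: cvg_cst.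
  by apply: cvg_expRN_ln; lra.
Qed.

Lemma cvg_edge_prob : p @ \oo --> (0 : R).
Proof.
apply: (@squeeze_cvgr _ _ _ _ (fun=> 0) (fun n => K * expR (- (15 / 16 * L n)))).
- by apply: filterS near_edge_prob => n [_ _ _ /andP[-> _] [_ ->]].
- exact: cvg_cst.
- rewrite -(mulr0 K); apply: cvgM; first exact: cvg_cst.
  by apply: cvg_expRN_ln; lra.
Qed.

(** This is the expected number of sinks. Written as [expR (L n + n ln (1 - p n))], its exponent is
    [- c - eps n] up to an error of [2 n (p n)^2]. *)
Lemma cvg_sinks_mean : (fun n => n%:R * q n ^+ n) @ \oo --> expR (- c).
Proof.
have p_small : \forall n \near \oo, `|p n| <= 2^-1.
  by apply: (@cvgr0_norm_le R R^o _ _ _ p cvg_edge_prob); rewrite invr_gt0.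
have h : (fun n => expR (L n + n%:R * ln (1 + - p n))) @ \oo --> expR (- c).
  apply: continuous_cvg; first exact: continuous_expR.
  apply: (@squeeze_cvgr _ _ _ _ (fun n => - c - eps n - 2 * (n%:R * p n ^+ 2))
    (fun n => - c - eps n)).
  - apply: filterS2 near_edge_prob p_small => n [[n0 _] _ _ /andP[p0 _] _] p2.
    have nR : 0 < n%:R :> R by rewrite ltr0n.
    have npE : n%:R * p n = L n + c + eps n by rewrite hp// mulrC divfK// gt_eqF.
    move: p2; rewrite ger0_norm// => p2.
    have l1 : ln (1 + - p n) <= - p n by rewrite le_ln1Dx//; lra.
    have l2 : - p n - 2 * p n ^+ 2 <= ln (1 + - p n).
      by have := @ln1D_ge R (- p n); rewrite sqrrN => -> //; lra.
    have := ler_wpM2l (ltW nR) l1; have := ler_wpM2l (ltW nR) l2.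
    by move=> h1 h2; apply/andP; split; lra.
  - suff : (fun n => - c - eps n - 2 * (n%:R * p n ^+ 2)) @ \oo --> - c - 0 - 2 * 0.
      by rewrite mulr0 !subr0.
    apply: cvgB; first by apply: cvgB => //; exact: cvg_cst.
    by apply: cvgM; [exact: cvg_cst|exact: cvg_sqr_edge_prob].
  - suff : (fun n => - c - eps n) @ \oo --> - c - 0 by rewrite subr0.
    by apply: cvgB => //; exact: cvg_cst.
apply: cvgn_near_eq h; apply: filterS2 near_edge_prob p_small => n [_ nL _ _ _] p2.
rewrite expRD -nL expRM_natl lnK ?posrE//.
by move: p2; rewrite ler_norml => /andP[]; lra.
Qed.

Let lam : R := expR (- c).

Lemma cvg_sinks_mean_pred : (fun n => n%:R * q n ^+ n.-1) @ \oo --> lam.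
Proof.
have q1 : (fun n => q n) @ \oo --> (1 : R).
  by rewrite -[X in _ --> X]subr0; apply: cvgB; [exact: cvg_cst|exact: cvg_edge_prob].
have h : (fun n => n%:R * q n ^+ n * (q n)^-1) @ \oo --> lam.
  rewrite -[lam]mulr1 -[X in _ * X]invr1; apply: cvgM; first exact: cvg_sinks_mean.
  by apply: cvgV => //; exact: oner_neq0.
have p_small : \forall n \near \oo, `|p n| <= 2^-1.
  by apply: (@cvgr0_norm_le R R^o _ _ _ p cvg_edge_prob); rewrite invr_gt0.
apply: cvgn_near_eq h.
apply: filterS2 near_edge_prob p_small => n [[n0 _] _ _ _ _] p2.
have q0 : q n != 0 by rewrite gt_eqF//; move: p2; rewrite ler_norml => /andP[]; lra.
have -> : q n ^+ n = q n ^+ n.-1 * q n by rewrite -exprSr prednK.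
by rewrite mulrA mulfK.
Qed.

Lemma cvg_no_sink : (fun n => (1 - q n ^+ n) ^+ n) @ \oo --> expR (- lam).
Proof.
apply: (@cvg_exp1D _ (fun n => - q n ^+ n)).
rewrite (_ : (fun n => _) = (fun n => - (n%:R * q n ^+ n))).
  by apply: cvgN; exact: cvg_sinks_mean.
by apply/funext => n; rewrite mulrN.
Qed.

Local Notation Pr n := (@gnp_prob R n (p n)).

Lemma cvg_gnp_le (u v : nat -> R) : (forall n, (0 < n)%N -> 0 <= p n <= 1 -> 0 <= u n <= v n) ->
  v @ \oo --> (0 : R) -> u @ \oo --> (0 : R).
Proof.
move=> uv v0; apply: (@squeeze_cvgr _ _ _ _ (fun=> 0) v) => //; last exact: cvg_cst.
by apply: filterS near_edge_prob => n [[n0 _] _ _ p01 _]; exact: uv.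
Qed.

Lemma cvg_bad_single : (fun n => Pr n (@bad_single n)) @ \oo --> (0 : R).
Proof.
apply: (cvg_gnp_le (v := fun n => n%:R * p n * q n ^+ n * (1 + 2 * q n ^+ n.-1) ^+ n)).
  by move=> n n0 p01; rewrite gnp_prob_ge0//= gnp_prob_bad_single.
rewrite (_ : (fun n => _) = (fun n => (n%:R * q n ^+ n) * p n * (1 + 2 * q n ^+ n.-1) ^+ n)).
  rewrite -[0](mul0r (expR (2 * lam))) -[X in X * _](mulr0 lam).
  apply: cvgM; first by apply: cvgM; [exact: cvg_sinks_mean|exact: cvg_edge_prob].
  apply: (@cvg_exp1D _ (fun n => 2 * q n ^+ n.-1)).
  rewrite (_ : (fun n => _) = (fun n => 2 * (n%:R * q n ^+ n.-1))).
    by apply: cvgM; [exact: cvg_cst|exact: cvg_sinks_mean_pred].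
  by apply/funext => n; rewrite mulrCA.
by apply/funext => n; congr (_ * _); rewrite mulrAC.
Qed.

(** For [z] of order [n^(-3/8)], the sum of [sqrt n * z^k] over [k >= 2] is at most
    [2 sqrt n * z^2], of order [n^(-1/4)]. *)
Lemma cvg_bad_cluster : (fun n => Pr n (@bad_cluster n)) @ \oo --> (0 : R).
Proof.
pose M := K ^+ 2 * expR (5 + C + 2 * expR C).
have small (a b x : R) : 0 < a -> 0 < x -> \forall n \near \oo, b * expR (- (a * L n)) <= x.
  move=> a0 x0; have h : (fun n => b * expR (- (a * L n))) @ \oo --> (0 : R).
    by rewrite -(mulr0 b); apply: cvgM; [exact: cvg_cst|exact: cvg_expRN_ln].
  apply: filterS (@cvgr0_norm_le R R^o _ _ _ _ h x x0) => n.
  by apply: le_trans; exact: ler_norm.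
have half0 : 0 < 2^-1 :> R by rewrite invr_gt0.
(* The first bound yields [p n * expR (L n / 2 + C / 2 + 1) <= 1], as [15 / 16 - 1 / 2 = 7 / 16];
   the second is [z <= 1 / 2] for the geometric sum. *)
have s1 := @small (7 / 16) (K * expR (C / 2 + 1)) 1 (ltac:(lra)) ltr01.
have s2 := @small (3 / 8) M 2^-1 (ltac:(lra)) half0.
have bound : \forall n \near \oo,
    0 <= Pr n (@bad_cluster n) <= 2 * M ^+ 2 * expR (- (1 / 4 * L n)).
  apply: filterS3 near_edge_prob s1 s2 => n.
  move=> [[n0 L0] nL np p01 [npK pK]] s1n s2n; rewrite gnp_prob_ge0//=.
  apply: le_trans (gnp_prob_bad_cluster n p01) _.
  have ps : p n * expR (L n / 2 + C / 2 + 1) <= 1.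
    apply: le_trans (ler_wpM2r (expR_ge0 _) pK) _; apply: le_trans s1n.
    by rewrite -!mulrA -!expRD ler_wpM2l ?(le_trans ler01 K1)// ler_expR; lra.
  set z := M * expR (- (3 / 8 * L n)) in s2n.
  have z0 : 0 <= z by rewrite !mulr_ge0 ?expR_ge0// exprn_ge0// (le_trans ler01 K1).
  apply: (@le_trans _ _ (\sum_(k < n.+1 | (1 < k)%N) expR (L n / 2) * z ^+ k)).
    rewrite big_mkcond [leRHS]big_mkcond; apply: ler_sum => k _.
    case: (ltnP 1 k) => //= k1; case: ifP => k2.
      apply: (@cluster_term_le R n k (p n) C (L n) K) => //.
      by rewrite -ltnS.
    by rewrite mulr_ge0 ?expR_ge0// exprn_ge0.
  rewrite -mulr_sumr; apply: le_trans (ler_wpM2l (expR_ge0 _) (sum_expr_ge2 _ _)) _.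
    by rewrite z0.
  have -> : expR (- (1 / 4 * L n)) = expR (L n / 2) * expR (- (3 / 8 * L n)) ^+ 2.
    by rewrite -expRM_natr -expRD; congr expR; field.
  by rewrite le_eqVlt; apply/orP; left; apply/eqP; rewrite /z; ring.
apply: (@squeeze_cvgr _ _ _ _ (fun=> 0) _ _ bound); first exact: cvg_cst.
rewrite -(mulr0 (2 * M ^+ 2)); apply: cvgM; first exact: cvg_cst.
by apply: cvg_expRN_ln; lra.
Qed.

Lemma cvg_sink_source_meet :
  (fun n => Pr n (fun E => sinks E :&: sources E <> finset.set0)) @ \oo --> (0 : R).
Proof.
apply: (cvg_gnp_le (v := fun n => n%:R * (q n ^+ n * q n ^+ n.-1))).
  by move=> n n0 p01; rewrite gnp_prob_ge0//= gnp_prob_sink_source_meet.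
rewrite (_ : (fun n => _) = (fun n => n%:R * q n ^+ n * q n ^+ n.-1)).
  rewrite -(mulr0 lam); apply: cvgM; first exact: cvg_sinks_mean.
  exact: cvg0_of_muln cvg_sinks_mean_pred.
by apply/funext => n; rewrite mulrA.
Qed.

(** Asymptotic independence: the error bound tends to [lam * (expR lam - expR lam) = 0]. *)
Lemma cvg_no_sink_source :
  (fun n => Pr n (fun E => sinks E = finset.set0 /\ sources E = finset.set0)) @ \oo
    --> expR (- lam) * expR (- lam).
Proof.
have dist0 : (fun n => `|Pr n (fun E => sinks E = finset.set0 /\ sources E = finset.set0)
    - (1 - q n ^+ n) ^+ (n + n)|) @ \oo --> (0 : R).
  apply: (cvg_gnp_le (v := fun n => n%:R * q n ^+ n *
      ((1 + q n ^+ n.-1) ^+ n - (1 + q n ^+ n) ^+ n))).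
    by move=> n n0 p01; rewrite normr_ge0/= gnp_prob_no_sink_source_dist.
  rewrite -(mulr0 lam) -(subrr (expR lam)); apply: cvgM; first exact: cvg_sinks_mean.
  apply: cvgB; first exact: (@cvg_exp1D _ (fun n => q n ^+ n.-1) _ cvg_sinks_mean_pred).
  exact: (@cvg_exp1D _ (fun n => q n ^+ n) _ cvg_sinks_mean).
have h : (fun n => (1 - q n ^+ n) ^+ (n + n)) @ \oo --> expR (- lam) * expR (- lam).
  rewrite (_ : (fun n => _) = (fun n => (1 - q n ^+ n) ^+ n * (1 - q n ^+ n) ^+ n)).
    by apply: cvgM; exact: cvg_no_sink.
  by apply/funext => n; rewrite exprD.
exact: cvgn_dist dist0 h.
Qed.

(** Outside an exceptional event, structural diagonalizability means that [sinks] or [sources] is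
    empty. The converse has the same law, so the bad events of both digraphs cost [B n] twice. *)
Lemma cvg_structurally_diagonalizable :
  (fun n => Pr n (@structurally_diagonalizable R n)) @ \oo
    --> 2 * expR (- lam) - expR (- lam) * expR (- lam).
Proof.
pose U n := Pr n (fun E => sinks E = finset.set0 \/ sources E = finset.set0).
have U_cvg : U @ \oo --> 2 * expR (- lam) - expR (- lam) * expR (- lam).
  have h : (fun n => 2 * (1 - q n ^+ n) ^+ n -
      Pr n (fun E => sinks E = finset.set0 /\ sources E = finset.set0)) @ \oo
      --> 2 * expR (- lam) - expR (- lam) * expR (- lam).
    apply: cvgB; last exact: cvg_no_sink_source.
    by apply: cvgM; [exact: cvg_cst|exact: cvg_no_sink].
  apply: cvgn_near_eq h; apply: filterS near_edge_prob => n [_ _ _ p01 _].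
  rewrite /U gnp_probD gnp_prob_no_sink// gnp_prob_no_source//.
  by congr (_ - _); rewrite /=; ring.
pose B n := Pr n (@bad_single n) + Pr n (@bad_cluster n).
have B0 : B @ \oo --> (0 : R).
  by rewrite -(addr0 0); apply: cvgD; [exact: cvg_bad_single|exact: cvg_bad_cluster].
have dist0 : (fun n => `|Pr n (@structurally_diagonalizable R n) - U n|) @ \oo --> (0 : R).
  apply: (cvg_gnp_le (v := fun n => B n + B n +
      Pr n (fun E => sinks E :&: sources E <> finset.set0))); last first.
    rewrite -(addr0 0); apply: cvgD; last exact: cvg_sink_source_meet.
    by rewrite -(addr0 0); apply: cvgD.
  case=> // n _ p01; rewrite normr_ge0 /=.
  apply: le_trans (gnp_prob_dist p01 (W := fun E => (bad E \/ bad (converse E)) \/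
    sinks E :&: sources E <> finset.set0) _) _.
    move=> E nW; apply: structurally_diagonalizableP.
    - by move=> b; apply: nW; left; left.
    - by move=> b; apply: nW; left; right.
    - by apply: contrapT => b; apply: nW; right.
  apply: le_trans (gnp_prob_or_le p01 _ _) _; rewrite lerD2r.
  apply: le_trans (gnp_prob_or_le p01 _ _) _.
  by rewrite gnp_prob_converse lerD// gnp_prob_or_le.
exact: cvgn_dist dist0 U_cvg.
Qed.

End Asymptotics.

Theorem theorem4p2 (R : realType) (c : R) (p eps : nat -> R)
    (heps : eps @ \oo --> 0)
    (hp : forall n : nat, (0 < n)%N -> p n = (ln n%:R + c + eps n) / n%:R) :
  let P (n : nat) : R := @gnp_prob R n (p n) (@structurally_diagonalizable R n) in
  cvgn P /\
  expR (- (2 * expR (- c))) * (1 + 2 * expR (- c) + expR (- (2 * c))) <= limn P.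
Proof.
move=> P; have Pl := cvg_structurally_diagonalizable heps hp.
split; first by apply/cvg_ex; eexists; exact: Pl.
rewrite (cvg_lim _ Pl)//; set lam := expR (- c).
have -> : expR (- (2 * c)) = lam ^+ 2 by rewrite -expRM_natl -mulrN.
have -> : expR (- (2 * lam)) = expR (- lam) * expR (- lam) by rewrite -expRD; congr expR; ring.
have := expR_ge1Dxx2 (expR_ge0 (- c)); rewrite -/lam => h.
have e1 : expR (- lam) * expR lam = 1 by rewrite -expRD addNr expR0.
have e0 := expR_ge0 (- lam).
(* This extracts the common factor; what remains is twice [h], minus 1. *)
have -> : 2 * expR (- lam) - expR (- lam) * expR (- lam) =
  expR (- lam) * expR (- lam) * (2 * expR lam - 1).
  by rewrite mulrBr mulr1 mulrCA -!mulrA e1 mulr1.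
by rewrite ler_wpM2l ?mulr_ge0//; lra.
Qed.
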